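(* Let $G_1$ and $G_2$ be finitely generated groups. Suppose there exist proper normal subgroups $H_1\lhd G_1$ and $H_2\lhd G_2$ of finite index such that $H_1\cong H_2$ via an isomorphism $\psi\colon H_1\to H_2$, and such that $\{1,w_1,\dots,w_1^{n_1-1}\}$ and $\{1,w_2,\dots,w_2^{n_2-1}\}$ are full sets of coset representatives of $H_1<G_1$ and $H_2<G_2$ for some $w_1\in G_1$, $w_2\in G_2$, where $n_i=[G_i:H_i]$. Then, for every subgroup $D$ with $\{1\}\le D\le H_1$, the nerve complex $\mathcal{NC}(G,\mathscr H_{\mathrm{fi}})$ and the order complex $\Delta P_{\mathrm{fi}}(G)$ are contractible for $G=G_1\ast_DG_2$.
   Context: $G_1\ast_DG_2$ denotes the amalgamated product of $G_1$ and $G_2$ in which each $d\in D\le H_1$ is identified with $\psi(d)\in H_2$. For a group $G$: $\mathscr H_{\mathrm{fi}}$ is the set of all proper finite index subgroups of $G$, and $P_{\mathrm{fi}}(G)=\{Hg\mid H<G \text{ proper},\ [G:H]<\infty,\ g\in G\}$ is the set of all right cosets of such subgroups, partially ordered by inclusion. The order complex $\Delta P$ of a poset $P$ is the simplicial complex whose $n$-simplices are the chains $C_0\subset C_1\subset\dots\subset C_n$ in $P$. The nerve complex $\mathcal{NC}(G,\mathscr H)$ of $G$ with respect to a set $\mathscr H$ of subgroups is the simplicial complex with an $n$-simplex for every set $\{H_0g_0,\dots,H_ng_n\}$ of $n+1$ cosets with $H_i\in\mathscr H$, $g_i\in G$ and $H_0g_0\cap\dots\cap H_ng_n\ne\emptyset$.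 *)

(* Defs.v *)
From HB Require Import structures.
From mathcomp Require Import all_boot all_order all_algebra.
From mathcomp Require Import generic_quotient finmap.
From mathcomp Require Import all_classical all_reals all_analysis.

Set Implicit Arguments.
Unset Strict Implicit.
Unset Printing Implicit Defensive.

Import Order.TTheory GRing.Theory Num.Theory.
Import numFieldNormedType.Exports.

Local Open Scope classical_set_scope.

Section Subgroups.
Local Open Scope group_scope.
Context {G : groupType}.
Implicit Types H K T : set G.

Definition is_subgroup H := group_closed [in H].

Definition is_normal H := is_subgroup H /\ forall g x, H x -> H (x ^ g).

Definition is_proper H := H != [set: G].

Definition right_coset H (g : G) : set G := [set x * g | x in H].

Definition right_cosets H : set (set G) := range (right_coset H).

Definition finite_index H := finite_set (right_cosets H).

Definition has_index H (n : nat) := (right_cosets H #= `I_n)%card.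

Definition coset_representatives H T :=
  forall C, right_cosets H C -> exists! x, (T `&` C) x.

Definition first_powers (w : G) (n : nat) : set G := [set w ^+ i | i in `I_n].

End Subgroups.

Definition finitely_generated (G : groupType) :=
  exists s : seq G, forall K : set G,
    is_subgroup K -> [set` s] `<=` K -> K = [set: G].

Definition is_isomorphism (G1 G2 : groupType) (H1 : set G1) (H2 : set G2)
    (psi : G1 -> G2) :=
  {in H1 &, {morph psi : x y / (x * y)%g}} /\ set_bij H1 H2 psi.

(* [amalgam D psi] is the set of words in the letters of [G1] and [G2] modulo
   the congruence generated by the multiplication tables of [G1] and [G2] and
   by the identification of each [d] in [D] with [psi d].  The values of [psi]
   outside [D] are irrelevant. *)
Section Amalgam.
Local Open Scope group_scope.
Local Open Scope quotient_scope.
Context {G1 G2 : groupType} (D : set G1) (psi : G1 -> G2).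

Notation letter := (G1 + G2)%type.
Notation word := (seq letter).

Inductive amalgam_eq : word -> word -> Prop :=
| amalgam_refl u : amalgam_eq u u
| amalgam_sym u v : amalgam_eq u v -> amalgam_eq v u
| amalgam_trans u v w : amalgam_eq u v -> amalgam_eq v w -> amalgam_eq u w
| amalgam_cat u u' v v' :
    amalgam_eq u u' -> amalgam_eq v v' -> amalgam_eq (u ++ v) (u' ++ v')
| amalgam_1l : amalgam_eq [:: inl 1] [::]
| amalgam_1r : amalgam_eq [:: inr 1] [::]
| amalgam_Ml x y : amalgam_eq [:: inl x; inl y] [:: inl (x * y)]
| amalgam_Mr x y : amalgam_eq [:: inr x; inr y] [:: inr (x * y)]
| amalgam_glue d : D d -> amalgam_eq [:: inl d] [:: inr (psi d)].

Definition amalgam_rel (u v : word) : bool := `[< amalgam_eq u v >].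

Fact amalgam_rel_refl : reflexive amalgam_rel.
Proof. by move=> u; apply/asboolP; exact: amalgam_refl. Qed.

Fact amalgam_rel_sym : symmetric amalgam_rel.
Proof. by move=> u v; apply/asboolP/asboolP; exact: amalgam_sym. Qed.

Fact amalgam_rel_trans : transitive amalgam_rel.
Proof.
move=> v u w /asboolP uv /asboolP vw; apply/asboolP.
exact: amalgam_trans uv vw.
Qed.

Canonical amalgam_equiv :=
  EquivRel amalgam_rel amalgam_rel_refl amalgam_rel_sym amalgam_rel_trans.

Definition amalgam := {eq_quot amalgam_equiv}.

HB.instance Definition _ := Choice.on amalgam.

Fact amalgam_piP (u v : word) :
  (\pi_({eq_quot amalgam_equiv}) u = \pi_({eq_quot amalgam_equiv}) v)
    <-> amalgam_eq u v.
Proof. by split=> [/eqmodP/asboolP|uv] //; apply/eqmodP/asboolP. Qed.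

Definition amalgam_class (u : word) : amalgam :=
  \pi_({eq_quot amalgam_equiv}) u.

Definition amalgam_word (a : amalgam) : word :=
  repr (a : {eq_quot amalgam_equiv}).

Fact amalgam_wordK : cancel amalgam_word amalgam_class.
Proof. by move=> a; exact: reprK. Qed.

Fact amalgam_classK u : amalgam_eq (amalgam_word (amalgam_class u)) u.
Proof. by apply/amalgam_piP; exact: reprK. Qed.

Definition inv_letter (l : letter) : letter :=
  match l with inl x => inl x^-1 | inr y => inr y^-1 end.

Definition inv_word (u : word) : word := rev (map inv_letter u).

Fact inv_letterV l : amalgam_eq [:: inv_letter l; l] [::].
Proof.
by case: l => x /=; [apply: amalgam_trans (amalgam_Ml _ _) _
                    |apply: amalgam_trans (amalgam_Mr _ _) _];
  rewrite mulVg; constructor.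
Qed.

Fact inv_wordK : involutive inv_word.
Proof.
move=> u; rewrite /inv_word map_rev revK -map_comp -[RHS]map_id.
by apply: eq_map => -[x|x] /=; rewrite invgK.
Qed.

Fact inv_wordV u : amalgam_eq (inv_word u ++ u) [::].
Proof.
elim: u => [|l u IH]; first exact: amalgam_refl.
rewrite /inv_word /= rev_cons -cats1 -catA -/(inv_word u).
apply: amalgam_trans IH; apply: amalgam_cat (amalgam_refl _) _.
rewrite -(cat1s l u) catA -[X in amalgam_eq _ X]cat0s.
by apply: amalgam_cat (inv_letterV l) (amalgam_refl _).
Qed.

Fact inv_wordVr u : amalgam_eq (u ++ inv_word u) [::].
Proof. by have := inv_wordV (inv_word u); rewrite inv_wordK. Qed.

Definition amalgam_mul (a b : amalgam) : amalgam :=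
  amalgam_class (amalgam_word a ++ amalgam_word b).

Definition amalgam_inv (a : amalgam) : amalgam :=
  amalgam_class (inv_word (amalgam_word a)).

Fact amalgam_mulE u v :
  amalgam_mul (amalgam_class u) (amalgam_class v) = amalgam_class (u ++ v).
Proof. by apply/amalgam_piP/amalgam_cat; exact: amalgam_classK. Qed.

Fact amalgam_mulA : associative amalgam_mul.
Proof.
move=> a b c; rewrite -[a]amalgam_wordK -[b]amalgam_wordK -[c]amalgam_wordK.
by rewrite !amalgam_mulE catA.
Qed.

Fact amalgam_mul1 : left_id (amalgam_class [::]) amalgam_mul.
Proof. by move=> a; rewrite -[a]amalgam_wordK amalgam_mulE. Qed.

Fact amalgam_mulr1 : right_id (amalgam_class [::]) amalgam_mul.
Proof. by move=> a; rewrite -[a]amalgam_wordK amalgam_mulE cats0. Qed.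

Fact amalgam_mulV : left_inverse (amalgam_class [::]) amalgam_inv amalgam_mul.
Proof.
move=> a; rewrite -[X in amalgam_mul _ X]amalgam_wordK amalgam_mulE.
by apply/amalgam_piP; exact: inv_wordV.
Qed.

Fact amalgam_mulVr :
  right_inverse (amalgam_class [::]) amalgam_inv amalgam_mul.
Proof.
move=> a; rewrite -[X in amalgam_mul X _]amalgam_wordK amalgam_mulE.
by apply/amalgam_piP; exact: inv_wordVr.
Qed.

HB.instance Definition _ := isGroup.Build amalgam amalgam_mulA amalgam_mul1
  amalgam_mulr1 amalgam_mulV amalgam_mulVr.

Definition amalgam_inl (x : G1) : amalgam := amalgam_class [:: inl x].
Definition amalgam_inr (y : G2) : amalgam := amalgam_class [:: inr y].

Lemma amalgam_inlM : {morph amalgam_inl : x y / x * y}.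
Proof.
by move=> x y; rewrite [RHS]amalgam_mulE; apply/amalgam_piP/amalgam_sym;
  exact: amalgam_Ml.
Qed.

Lemma amalgam_inrM : {morph amalgam_inr : x y / x * y}.
Proof.
by move=> x y; rewrite [RHS]amalgam_mulE; apply/amalgam_piP/amalgam_sym;
  exact: amalgam_Mr.
Qed.

Lemma amalgam_inlr d : D d -> amalgam_inl d = amalgam_inr (psi d).
Proof. by move=> Dd; apply/amalgam_piP; exact: amalgam_glue. Qed.

Lemma amalgam_universal (K : groupType) (f1 : G1 -> K) (f2 : G2 -> K) :
    {morph f1 : x y / x * y} -> {morph f2 : x y / x * y} ->
    (forall d, D d -> f1 d = f2 (psi d)) ->
  exists! f : amalgam -> K, [/\ {morph f : a b / a * b},
    (forall x, f (amalgam_inl x) = f1 x) & forall y, f (amalgam_inr y) = f2 y].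
Proof.
have morph1 (L M : groupType) (f : L -> M) :
    {morph f : x y / x * y} -> f 1 = 1.
  by move=> fM; apply: (mulgI (f 1)); rewrite -fM !mulg1.
move=> f1M f2M f12.
pose fl (l : letter) := match l with inl x => f1 x | inr y => f2 y end.
pose fw (u : word) := foldr (fun l k => fl l * k) 1 u.
have fw_cat u v : fw (u ++ v) = fw u * fw v.
  by elim: u => [|l u IH] /=; rewrite ?mul1g// IH mulgA.
have fwP u v : amalgam_eq u v -> fw u = fw v.
  elim=> //=.
  - by move=> u1 v1 w1 _ -> _ ->.
  - by move=> u1 u2 v1 v2 _ e1 _ e2; rewrite !fw_cat e1 e2.
  - by rewrite mulg1 morph1.
  - by rewrite mulg1 morph1.
  - by move=> x y; rewrite !mulg1 f1M.
  - by move=> x y; rewrite !mulg1 f2M.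
  - by move=> d Dd; rewrite !mulg1 f12.
pose f (a : amalgam) := fw (amalgam_word a).
have fE u : f (amalgam_class u) = fw u by exact/fwP/amalgam_classK.
exists f; split; first split.
- move=> a b; rewrite -[a]amalgam_wordK -[b]amalgam_wordK.
  by rewrite [X in f X]amalgam_mulE !fE fw_cat.
- by move=> x; rewrite fE /= mulg1.
- by move=> y; rewrite fE /= mulg1.
move=> g [gM g1 g2]; apply/funext => a.
rewrite -[a]amalgam_wordK fE; elim: (amalgam_word a) => [|l u IH] /=.
  by rewrite -(morph1 _ _ _ gM).
rewrite IH -cat1s -amalgam_mulE [RHS]gM; congr (_ * _).
by case: l => x; rewrite /= -?g1 -?g2.
Qed.

End Amalgam.

(* A complex is given by its simplices, viewed as finite sets of vertices; an
   element [v] of [V] is a vertex when [[fset v]] is a simplex. *)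
Record simplicial_complex (V : choiceType) := SimplicialComplex {
  simplices : set {fset V};
  simplex_neq0 : forall s, simplices s -> s != fset0;
  simplex_face : forall s t : {fset V}, simplices s ->
    (t `<=` s)%fset -> t != fset0 -> simplices t
}.

Section Realization.
Local Open Scope ring_scope.
Context {R : realType} {V : choiceType}.

(* The closed geometric simplex on [s], in barycentric coordinates. *)
Definition closed_simplex (s : {fset V}) : set (V -> R) :=
  [set x | [/\ forall v, 0 <= x v, forall v, v \notin s -> x v = 0
             & \sum_(v <- s) x v = 1]].

Record realization (K : simplicial_complex V) := Realization {
  coordinates :> V -> R;
  coordinatesP : exists2 s, simplices K s & closed_simplex s coordinates
}.

HB.instance Definition _ (K : simplicial_complex V) :=
  gen_eqMixin (realization K).
HB.instance Definition _ (K : simplicial_complex V) :=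
  gen_choiceMixin (realization K).

(* The weak topology: [U] is open if and only if its trace on each closed
   simplex [s] is open for the Euclidean topology, here given by the sup norm
   on the coordinates indexed by [s]. *)
Definition realization_open (K : simplicial_complex V)
    (U : set (realization K)) :=
  forall s, simplices K s -> forall x, U x -> closed_simplex s x ->
    exists2 e : R, 0 < e &
      forall y : realization K, closed_simplex s y ->
        (forall v, v \in s -> `|x v - y v| < e) -> U y.

Section Topology.
Variable K : simplicial_complex V.

Fact realization_openT : realization_open [set: realization K].
Proof. by move=> s _ x _ _; exists 1. Qed.

Fact realization_openI : setI_closed (@realization_open K).
Proof.
move=> A B oA oB s Ks x [Ax Bx] sx.
have [e e0 eA] := oA s Ks x Ax sx; have [f f0 fB] := oB s Ks x Bx sx.
exists (Num.min e f); first by rewrite lt_min e0.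
by move=> y sy xy; split; [apply: eA|apply: fB] => // v vs;
  have := xy v vs; rewrite lt_min => /andP[].
Qed.

Fact realization_open_bigU (I : Type) (f : I -> set (realization K)) :
  (forall i, realization_open (f i)) -> realization_open (\bigcup_i f i).
Proof.
move=> of_ s Ks x [i _ fx] sx; have [e e0 ef] := of_ i s Ks x fx sx.
by exists e => // y sy xy; exists i => //; exact: ef.
Qed.

HB.instance Definition _ := isOpenTopological.Build (realization K)
  realization_openT realization_openI realization_open_bigU.

End Topology.
End Realization.
Arguments realization R {V} K.

Definition contractible (R : realType) (X : topologicalType) :=
  exists (x0 : X) (h : R * X -> X),
    [/\ {within `[0%R, 1%R] `*` [set: X], continuous h},
        forall x, h (0%R, x) = x & forall x, h (1%R, x) = x0].

Definition contractible_complex (R : realType) (V : choiceType)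
    (K : simplicial_complex V) :=
  contractible R (realization R K).

(* For [T] of the form [set G], [x >=< y] is comparability for inclusion. *)
Section OrderComplex.
Context {d : Order.disp_t} {T : porderType d} (P : set T).

Definition chains : set {fset T} :=
  [set s | [/\ s != fset0, forall x, x \in s -> P x
             & {in s &, forall x y, (x >=< y)%O}]].

Fact chains_face (s t : {fset T}) :
  chains s -> (t `<=` s)%fset -> t != fset0 -> chains t.
Proof.
move=> [_ sP sC] /fsubsetP ts t0; split=> // [x /ts/sP //|x y /ts xs /ts ys].
exact: sC.
Qed.

Definition order_complex :=
  @SimplicialComplex T chains (fun s '(And3 s0 _ _) => s0) chains_face.

End OrderComplex.

Section CosetComplexes.
Context {G : groupType}.

Definition subgroup_cosets (F : set (set G)) : set (set G) :=
  [set C | exists2 H, F H & right_cosets H C].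

Definition intersecting_cosets (F : set (set G)) : set {fset set G} :=
  [set s | [/\ s != fset0, forall C, C \in s -> subgroup_cosets F C
             & \bigcap_(C in [set` s]) C !=set0]].

Fact intersecting_cosets_face (F : set (set G)) (s t : {fset set G}) :
  intersecting_cosets F s -> (t `<=` s)%fset -> t != fset0 ->
  intersecting_cosets F t.
Proof.
move=> [_ sF [g sg]] /fsubsetP ts t0; split=> // [C /ts/sF //|].
by exists g => C /ts; exact: sg.
Qed.

Definition nerve_complex (F : set (set G)) :=
  @SimplicialComplex (set G) (intersecting_cosets F)
    (fun s '(And3 s0 _ _) => s0) (@intersecting_cosets_face F).

End CosetComplexes.

Definition proper_finite_index (G : groupType) : set (set G) :=
  [set H | [/\ is_subgroup H, is_proper H & finite_index H]].
Arguments proper_finite_index G : clear implicits.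

Definition coset_poset (G : groupType) : set (set G) :=
  subgroup_cosets (proper_finite_index G).
Arguments coset_poset G : clear implicits.

(* Main.v *)
From HB Require Import structures.
Require Import Defs.
From mathcomp Require Import all_boot all_order all_algebra.
From mathcomp Require Import fingroup perm finmap.
From mathcomp Require Import all_classical all_reals all_analysis.
From mathcomp Require Import ring lra zify.

Set Implicit Arguments.
Unset Strict Implicit.
Unset Printing Implicit Defensive.

Import Order.TTheory GRing.Theory Num.Theory.
Import numFieldNormedType.Exports.

Local Open Scope classical_set_scope.

(** Why the theorem holds.

    A group [G] has contractible coset complexes as soon as
    - it has countably many finite index subgroups, and
    - for each finite index subgroup [N] some proper finite index subgroup [M]
      meets every coset of [N]
    ([coset_complexes_contractible]).  Such an [M] is the apex of a cone: a
    coset [v] that is a union of [N]-cosets can be shrunk to [v `&` M], which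
    then grows to [M].  Every finite subcomplex can thus be contracted, and the
    homotopies can be combined into one explicit contraction.  Choose normal
    finite index subgroups [N_0 = G], [N_1], [N_2], ..., each contained in the
    preceding one, such that every finite index subgroup contains some [N_n],
    and let [M_n] meet all cosets of [N_n].  The [n]-th stage leaves the unions
    of [N_n]-cosets in place and sends any other coset [v] to [N_n v `&` M_n].
    So stage 0 is constant, each vertex is fixed from some stage on, and
    finitely many simplicial moves lead from stage [n.+1] to stage [n]
    ([push], [filtration_contractible]).  All these moves, run in the order of
    decreasing [n] within the unit interval, define a homotopy from the identity
    to a constant map; it is continuous because each closed simplex takes part
    in finitely many moves and the topology of the realization is determined by
    the closed simplices ([contiguous_sequence_contractible]).

    For the amalgamated product, countability comes from finite generation:
    a finite index subgroup is the set of elements spelled by the words that a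
    finite automaton accepts ([finitely_generated_enumeration]).  For the
    subgroups [M], kill [H1] and [H2].  What remains are the cyclic groups of
    orders [n1] and [n2], so that two permutations [s] and [t] with
    [s ^+ n1 = 1] and [t ^+ n2 = 1] determine an action of the amalgamated
    product.  Arrange [e] cycles of length [n1] and [e] cycles of length [n2]
    alternately in a chain, consecutive cycles having one point in common.
    The product of the two permutations obtained is a cycle through all the
    [m = 1 + e (n1 + n2 - 2)] points ([long_cycle_product]).  Hence
    [w = w2 w1] acts as a cycle whose length is prime to [e], and the powers
    of [w ^+ e] still act transitively.  If [w ^+ e] lies in [N], then [N]
    permutes the points transitively, that is, the stabilizer [M] of a point
    meets all cosets of [N] ([supplement_of_long_cycles]). *)

(** * Deforming the realization of a complex *)

Section Deformation.
Local Open Scope ring_scope.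
Context {R : realType} {V : choiceType} (K : simplicial_complex V).
Implicit Types (s t : {fset V}) (x y : realization R K).

Lemma realization_eq x y : (forall v, x v = y v) -> x = y.
Proof.
case: x y => [f hf] [g hg] /= /funext fg; rewrite {}fg in hf *.
by congr Realization; exact: Prop_irrelevance.
Qed.

Definition carrier x : {fset V} := sval (cid2 (coordinatesP x)).

Lemma carrierP x : simplices K (carrier x) /\ closed_simplex (carrier x) x.
Proof. by rewrite /carrier; case: cid2. Qed.

Lemma sum_support s t (x : V -> R) (f : V -> R) :
    (forall v, v \notin s -> x v = 0) -> (forall v, v \notin t -> x v = 0) ->
  \sum_(v <- s) x v * f v = \sum_(v <- t) x v * f v.
Proof.
move=> xs xt; have sub u : (forall v, v \notin u -> x v = 0) ->
    \sum_(v <- (s `|` t)%fset) x v * f v =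
    \sum_(v <- (s `|` t)%fset | v \in u) x v * f v.
  move=> xu; rewrite [RHS]big_mkcond /=; apply: eq_bigr => v _.
  by case: ifPn => // /xu ->; rewrite mul0r.
have toset u : (u `<=` s `|` t)%fset ->
    \sum_(v <- (s `|` t)%fset | v \in u) x v * f v = \sum_(v <- u) x v * f v.
  move=> us; rewrite -big_filter; apply: perm_big; apply: uniq_perm.
  - exact/filter_uniq/fset_uniq.
  - exact: fset_uniq.
  - by move=> v; rewrite mem_filter andb_idr// => /(fsubsetP us).
by rewrite -(toset s) ?fsubsetUl// -(toset t) ?fsubsetUr// -!sub.
Qed.

Lemma closed_simplex_le1 s (x : V -> R) v : closed_simplex s x -> x v <= 1.
Proof.
move=> [x0 xs <-]; have [vs|/xs ->] := boolP (v \in s); last exact: sumr_ge0.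
by rewrite (big_fsetD1 v)//= lerDl sumr_ge0.
Qed.

Lemma closed_simplex_support s t (x : V -> R) :
    closed_simplex s x -> (forall v, v \notin t -> x v = 0) ->
  closed_simplex t x.
Proof.
move=> [x0 xs x1] xt; split=> //; rewrite -x1.
under eq_bigr do rewrite -[x _]mulr1.
under [RHS]eq_bigr do rewrite -[x _]mulr1.
exact: sum_support.
Qed.

(** On the points carried by a given finite set of vertices, the weak topology
    is the metric one: finitely many simplices matter, and those that do not
    contain [x] stay at a positive distance from it. *)
Lemma open_finite_vertices (U : set (realization R K)) (s : {fset V}) x :
  realization_open U -> U x -> (forall v, v \notin s -> x v = 0) ->
  exists2 e : R, 0 < e & forall y, (forall v, v \notin s -> y v = 0) ->
    (forall v, `|x v - y v| < e) -> U y.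
Proof.
move=> oU Ux xs.
have loc t : exists2 e : R, 0 < e & forall y,
    simplices K t -> closed_simplex t y ->
    (forall v, `|x v - y v| < e) -> U y.
  have [Kt|nKt] := pselect (simplices K t); last by exists 1.
  have [tx|ntx] := pselect (closed_simplex t x).
    have [e e0 eU] := oU t Kt x Ux tx; exists e => // y _ ty xy; exact: eU.
  (* [t] misses a vertex of the carrier of [x]. *)
  have [v vt xv0] : exists2 v, v \notin t & x v != 0.
    apply: contrapT => nv; apply: ntx.
    have xt v : v \notin t -> x v = 0.
      by move=> vt; apply/eqP; apply: contrapT => /negP xv; apply: nv; exists v.
    exact: closed_simplex_support (carrierP x).2 xt.
  exists `|x v|; first by rewrite normr_gt0.
  by move=> y _ [_ yt _] /(_ v); rewrite (yt v vt) subr0 ltxx.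
have fin (l : seq {fset V}) : exists2 e : R, 0 < e & forall t, t \in l ->
    forall y, simplices K t -> closed_simplex t y ->
    (forall v, `|x v - y v| < e) -> U y.
  elim: l => [|t l [e e0 IH]]; first by exists 1.
  have [f f0 fP] := loc t; exists (Num.min e f); first by rewrite lt_min e0.
  move=> t'; rewrite inE => /predU1P[->{t'}|t'l] y Kt ty xy;
    [apply: fP|apply: (IH t')] => // v;
    by have := xy v; rewrite lt_min => /andP[].
have [e e0 eP] := fin (enum_fset (fpowerset s)).
exists e => // y ys xy.
have [Kc cy] := carrierP y.
pose t := (carrier y `&` s)%fset.
have ty : closed_simplex t y.
  apply: (closed_simplex_support cy) => v.
  by rewrite inE negb_and => /orP[|/ys//]; case: cy => _ yc _ /yc.
apply: (eP t) => //; first by rewrite fpowersetE fsubsetIr.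
apply: (simplex_face Kc); first exact: fsubsetIl.
apply/eqP => t0; case: ty => _ _; rewrite t0 big_seq_fset0 => /eqP.
by rewrite eq_sym oner_eq0.
Qed.

End Deformation.

(** Paths starting at the vertices extend linearly to the closed simplices.
    The result is a homotopy provided that the vertices of a simplex move at
    any time in a common simplex. *)
Section LinearDeformation.
Local Open Scope ring_scope.
Context {R : realType} {V : choiceType} (K : simplicial_complex V).
(* [P v r] is the position at time [r] of the point that starts at [v], in
   barycentric coordinates; it never leaves the finite set of vertices [S v]. *)
Context (P : V -> R -> V -> R) (S : V -> {fset V}).
Hypothesis P_simplex : forall s r, simplices K s ->
  exists2 t, simplices K t & forall v, v \in s -> closed_simplex t (P v r).
Hypothesis P_support : forall v r u,
  simplices K [fset v]%fset -> u \notin S v -> P v r u = 0.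
Hypothesis P_continuous : forall v u, simplices K [fset v]%fset ->
  continuous (fun r => P v r u).
Implicit Types (s t : {fset V}) (x y : realization R K) (r : R).

Definition deform_coord r x u : R := \sum_(v <- carrier x) x v * P v r u.

Lemma deform_coordE s r x u : closed_simplex s x ->
  deform_coord r x u = \sum_(v <- s) x v * P v r u.
Proof.
move=> [_ xs _]; apply: sum_support => //.
by case: (carrierP x) => _ [].
Qed.

Fact deform_subproof r x :
  exists2 s, simplices K s & closed_simplex s (deform_coord r x).
Proof.
have [Ks [x0 xs x1]] := carrierP x.
have [t Kt tP] := P_simplex r Ks.
exists t => //; split.
- move=> u; rewrite /deform_coord big_seq; apply: sumr_ge0 => v vs.
  by apply: mulr_ge0 => //; case: (tP v vs).
- move=> u ut; rewrite /deform_coord big_seq big1// => v vs.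
  by case: (tP v vs) => _ -> //; rewrite mulr0.
- rewrite exchange_big/= -x1 big_seq [RHS]big_seq; apply: eq_bigr => v vs.
  by rewrite -mulr_sumr; case: (tP v vs) => _ _ ->; rewrite mulr1.
Qed.

Definition deform (z : R * realization R K) : realization R K :=
  Realization (deform_subproof z.1 z.2).

Lemma near_all_seq (T : eqType) (F : set_system R) {FF : Filter F}
    (l : seq T) (Q : T -> R -> Prop) :
  (forall a, a \in l -> \forall r \near F, Q a r) ->
  \forall r \near F, forall a, a \in l -> Q a r.
Proof.
elim: l => [|a l IH] lQ; first by apply: nearW.
have aQ := lQ a (mem_head _ _).
have {}IH : \forall r \near F, forall b, b \in l -> Q b r.
  by apply: IH => b bl; apply: lQ; rewrite inE bl orbT.
near=> r => b; rewrite inE => /predU1P[->|bl].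
  by near: r.
by apply: (near IH r) => //; near: r; exact: IH.
Unshelve. all: by end_near. Qed.

Lemma simplex_vertex s v :
  simplices K s -> v \in s -> simplices K [fset v]%fset.
Proof.
move=> Ks vs; apply: (simplex_face Ks); first by rewrite fsub1set.
by apply/fset0Pn; exists v; rewrite inE.
Qed.

Lemma P_bound v r u : simplices K [fset v]%fset -> 0 <= P v r u <= 1.
Proof.
move=> Kv; have [t Kt tP] := P_simplex r Kv.
have tv := tP v (fset11 v); rewrite (closed_simplex_le1 _ tv) andbT.
by case: tv.
Qed.

(** Continuity on the product of the line and a closed simplex: the points
    involved are carried by the finite set of vertices [T] below, and on it
    neighborhoods are metric by [open_finite_vertices]. *)
Lemma deform_local (U : set (realization R K)) s r x :
  realization_open U -> simplices K s -> closed_simplex s x ->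
  U (deform (r, x)) ->
  exists2 e : R, 0 < e & forall r' y, `|r - r'| < e -> closed_simplex s y ->
    (forall v, v \in s -> `|x v - y v| < e) -> U (deform (r', y)).
Proof.
move=> oU Ks sx Ux.
pose T := (\bigcup_(v <- s) S v)%fset.
have TS v : v \in s -> (S v `<=` T)%fset by move=> vs; exact: bigfcup_sup.
have supp r' y : closed_simplex s y ->
    forall u, u \notin T -> deform (r', y) u = 0.
  move=> sy u uT; rewrite /= (deform_coordE _ _ sy) big_seq big1// => v vs.
  rewrite P_support ?mulr0//; first exact: simplex_vertex Ks vs.
  by apply: contra uT => /(fsubsetP (TS v vs)).
have [e e0 eU] := open_finite_vertices oU Ux (supp _ _ sx).
pose n : R := (size (enum_fset s)).+1%:R.
have n0 : 0 < n by rewrite ltr0n.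
pose d := e / (2 * n); have d0 : 0 < d by rewrite divr_gt0// mulr_gt0.
have : \forall r' \near r, forall a, a \in [seq (v, u) | v <- s, u <- T] ->
    `|P a.1 r a.2 - P a.1 r' a.2| < d.
  apply: (@near_all_seq _ (nbhs r) _ _
    (fun a r' => `|P a.1 r a.2 - P a.1 r' a.2| < d)).
  move=> -[v u] /allpairsP[[v' u'] [/= vs uT [-> ->]]] /=.
  have := P_continuous (u := u') (simplex_vertex Ks vs).
  by move=> /(_ r)/cvgr_dist_lt/(_ d d0).
move=> /nbhs_ballP[f /= f0 fP].
exists (Num.min d f); first by rewrite lt_min d0.
move=> r' y; rewrite lt_min => /andP[_ rf] sy xy.
apply: eU; first exact: supp.
move=> u; have [uT|uT] := boolP (u \in T); last by rewrite !supp// subrr normr0.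
rewrite /= !(deform_coordE _ _ sx) !(deform_coordE _ _ sy) -sumrB.
apply: (le_lt_trans (ler_norm_sum _ _ _)).
apply: (@le_lt_trans _ _ (\sum_(v <- s) 2 * d)).
  rewrite big_seq [leRHS]big_seq; apply: ler_sum => v vs.
  have -> : x v * P v r u - y v * P v r' u =
    (x v - y v) * P v r' u + x v * (P v r u - P v r' u) by ring.
  apply: (le_trans (ler_normD _ _)); rewrite !normrM mulrDl !mul1r.
  have /andP[p0 p1] := P_bound r' u (simplex_vertex Ks vs).
  have x1 := closed_simplex_le1 v sx; have x0 : 0 <= x v by case: sx.
  have xyd : `|x v - y v| < d by have := xy v vs; rewrite lt_min => /andP[].
  have Pd : `|P v r u - P v r' u| < d.
    by apply: (fP r' rf (v, u)); apply/allpairsP; exists (v, u).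
  rewrite (ger0_norm p0) (ger0_norm x0); apply: lerD.
    by rewrite -[leRHS]mulr1; apply: ler_pM => //; exact: ltW.
  by rewrite -[leRHS]mul1r; apply: ler_pM => //; exact: ltW.
rewrite big_const_seq count_predT iter_addr_0 -[ltLHS]mulr_natr /d.
have -> : 2 * (e / (2 * n)) * (size (enum_fset s))%:R =
    e * ((size (enum_fset s))%:R / n).
  by field; rewrite gt_eqF.
rewrite -[ltRHS]mulr1 ltr_pM2l// ltr_pdivrMr// mul1r /n ltr_nat.
exact: ltnSn.
Qed.

(** [R * realization R K] carries the product topology, whereas [deform_local]
    controls one closed simplex at a time.  A tube around a compact interval of
    times repairs this: the points that stay in [W] throughout the interval
    form a set whose trace on each closed simplex is open. *)
Lemma deform_continuous : continuous deform.
Proof.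
move=> [r x] U; rewrite nbhsE => -[W [oW Wx] WU].
have {}oW : realization_open W by [].
have [Ks sx] := carrierP x.
have [e e0 eW] := deform_local oW Ks sx Wx.
have e20 : 0 < e / 2 by rewrite divr_gt0.
pose I := `[r - e / 2, r + e / 2]%classic.
pose N := [set y : realization R K | forall r', I r' -> W (deform (r', y))].
have oN : realization_open N.
  move=> s {}Ks y Ny sy.
  have /compact_near_coveringP ncov : compact I by exact: segment_compact.
  pose Q (d r' : R) := forall z : realization R K, closed_simplex s z ->
    (forall v, v \in s -> `|y v - z v| < d) -> W (deform (r', z)).
  have Qloc r' : I r' -> \forall r'' \near r' & d \near 0^'+, Q d r''.
    move=> Ir'; have [d d0 dW] := deform_local oW Ks sy (Ny r' Ir').
    exists (ball r' d, [set i | i < d]); first split => /=.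
    - exact: nbhsx_ballx.
    - exact: nbhs_right_lt.
    - move=> [r'' i] [/= r''d id] z sz yz; apply: dW => // v vs.
      exact: lt_trans (yz v vs) id.
  have Qcov := ncov R 0^'+ Q (at_right_proper_filter 0) Qloc.
  have [d [/= d0 dW]] := filter_ex (filterI (nbhs_right_gt (0 : R)) Qcov).
  by exists d => // z sz yz r' Ir'; exact: dW.
have Nx : N x.
  move=> r'; rewrite /I/= in_itv/= => /andP[r1 r2]; apply: eW => // [|v _].
    rewrite ltr_norml; apply/andP; split; lra.
  by rewrite subrr normr0.
exists (ball r (e / 2), N).
  split=> /=; first exact: nbhsx_ballx.
  exact: open_nbhs_nbhs.
move=> [r' y] [/= rr' Ny]; apply: WU; apply: Ny.
move: rr'; rewrite /ball/= ltr_norml => /andP[r1 r2].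
rewrite /I/= in_itv/=; apply/andP; split; lra.
Qed.

Lemma deform_contractible c :
  (forall v u, P v 0 u = (u == v)%:R) ->
  (forall v u, simplices K [fset v]%fset -> P v 1 u = (u == c)%:R) ->
  simplices K [fset c]%fset -> contractible_complex R K.
Proof.
move=> P0 P1 Kc.
have c1 : exists2 s,
    simplices K s & closed_simplex s (fun u => (u == c)%:R : R).
  exists [fset c]%fset => //; split=> [u|u|]; rewrite ?inE ?ler0n//.
    by move=> /negbTE ->.
  by rewrite big_seq_fset1 eqxx.
exists (Realization c1), deform; split.
- exact/continuous_subspaceT/deform_continuous.
- move=> x; apply: realization_eq => u /=; rewrite /deform_coord.
  have [_ [_ xs _]] := carrierP x.
  have [us|us] := boolP (u \in carrier x).
    rewrite (big_fsetD1 u)//= P0 eqxx mulr1 big_seq big1 ?addr0// => v.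
    by rewrite !inE P0 eq_sym => /andP[/negbTE -> _]; rewrite mulr0.
  rewrite xs// big_seq big1// => v vs; rewrite P0.
  case: eqP => [uv|]; rewrite ?mulr0//.
  by rewrite uv vs in us.
- move=> x; apply: realization_eq => u /=; rewrite /deform_coord.
  have [Kx [_ xs x1]] := carrierP x.
  rewrite big_seq (eq_bigr (fun v => x v * (u == c)%:R)) => [|v vs].
    by rewrite -big_seq -mulr_suml x1 mul1r.
  by rewrite P1//; exact: simplex_vertex Kx vs.
Qed.

End LinearDeformation.

(** * Sequences of contiguous maps *)

Definition contiguous (V : choiceType) (K : simplicial_complex V)
    (f g : V -> V) :=
  forall s, simplices K s -> simplices K (f @` s `|` g @` s)%fset.

(** Contiguous maps are homotopic along straight lines.  For a sequence [w] of
    consecutively contiguous maps that fixes each vertex from some index on,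
    infinitely many such homotopies can be traversed in finite time: the one
    from [w e.+1] to [w e] takes place for [r] between [1 / e.+2] and
    [1 / e.+1], and the identity is reached at [r = 0]. *)
Section ContiguousSequence.
Local Open Scope ring_scope.
Context {R : realType} {V : choiceType} (K : simplicial_complex V).
Context (w : nat -> V -> V) (E : V -> nat).
Hypothesis w_contig : forall e, contiguous K (w e) (w e.+1).
Hypothesis w_eventually : forall v, simplices K [fset v]%fset ->
  forall e, (E v <= e)%N -> w e v = v.

(** The fraction of the homotopy from [w e.+1] to [w e] completed at time [r]:
    the affine function with value 0 at [1 / e.+2] and 1 at [1 / e.+1], cut off
    outside of the unit interval. *)
Definition progress (e : nat) (r : R) : R :=
  Num.min 1 (Num.max 0 (e.+1%:R * (e.+2%:R * r - 1))).

Lemma progress_itv e r : 0 <= progress e r <= 1.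
Proof. by rewrite /progress le_min ler01 le_max lexx ge_min lexx. Qed.

Lemma progress0 e r : e.+2%:R * r <= 1 -> progress e r = 0.
Proof.
move=> h; rewrite /progress max_l ?min_r//.
by rewrite pmulr_rle0 ?ltr0n// subr_le0.
Qed.

Lemma progress1 e r : 1 <= e.+1%:R * r -> progress e r = 1.
Proof.
move=> h; rewrite /progress min_l// le_max; apply/orP; right.
rewrite mulrBr mulr1 mulrA [X in X * r]mulrC -mulrA.
rewrite [e.+2%:R]mulrS mulrDl mul1r.
have : e.+1%:R <= (e.+1%:R : R) * (e.+1%:R * r) by rewrite ler_peMr.
lra.
Qed.

Lemma progress_continuous e : continuous (progress e).
Proof.
move=> r.
have -> : progress e =
    cst 1 \min (cst 0 \max (fun r => e.+1%:R * (e.+2%:R * r - 1))).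
  by apply/funext.
apply: (@continuous_min R R); first exact: cvg_cst.
apply: (@continuous_max R R); first exact: cvg_cst.
apply: cvgM; first exact: cvg_cst.
apply: cvgB; last exact: cvg_cst.
by apply: cvgM; first exact: cvg_cst.
Qed.

Lemma progress_time r : 0 < r -> exists e,
  (forall j, (j < e)%N -> progress j r = 0) /\
  (forall j, (e < j)%N -> progress j r = 1).
Proof.
move=> r0.
have ex : exists e, 1 <= e.+2%:R * r.
  exists (Num.truncn r^-1); rewrite -ler_pdivrMr// div1r ltW//.
  by apply: (lt_trans (real_truncnS_gt (num_real _))); rewrite ltr_nat.
case: (ex_minnP ex) => e e1 emin; exists e; split=> j je.
  apply: progress0; rewrite leNgt; apply/negP => /ltW/emin.
  by rewrite leqNgt je.
apply: progress1; apply: (le_trans e1).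
by rewrite ler_pM2r// ler_nat.
Qed.

(** The sum telescopes to the edge path through [w (E v) v = v], ...,
    [w 1 v], [w 0 v] ([trackE]); in this form, continuity in [r] is plain. *)
Definition track v (r : R) u : R := (u == v)%:R +
  \sum_(0 <= e < E v) progress e r * ((u == w e v)%:R - (u == w e.+1 v)%:R).

Lemma track_before v r u : r <= 0 -> track v r u = (u == v)%:R.
Proof.
move=> r0; rewrite /track big1 ?addr0// => e _.
rewrite progress0 ?mul0r//; apply: (@le_trans _ _ 0) => //.
by rewrite mulr_ge0_le0.
Qed.

Lemma trackE v r u e : simplices K [fset v]%fset ->
    (forall j, (j < e)%N -> progress j r = 0) ->
    (forall j, (e < j)%N -> progress j r = 1) ->
  track v r u =
    progress e r * (u == w e v)%:R + (1 - progress e r) * (u == w e.+1 v)%:R.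
Proof.
move=> Kv p0 p1; rewrite /track; have wE := w_eventually Kv.
have [Ee|eE] := leqP (E v) e.
  rewrite !wE//; last exact: leq_trans Ee _.
  rewrite big_nat big1 ?addr0; last first.
    by move=> j /andP[_ jE]; rewrite p0 ?mul0r//; exact: leq_trans jE Ee.
  ring.
rewrite (big_cat_nat (n := e))//=; last exact: ltnW.
rewrite big_nat big1 ?add0r; last first.
  by move=> j /andP[_ jE]; rewrite p0 ?mul0r.
rewrite big_ltn// big_nat.
rewrite (eq_bigr (fun j => (u == w j v)%:R - (u == w j.+1 v)%:R)); last first.
  by move=> j /andP[ej _]; rewrite p1// mul1r.
rewrite -big_nat.
have -> : \sum_(e.+1 <= j < E v) ((u == w j v)%:R - (u == w j.+1 v)%:R : R)
   = (u == w e.+1 v)%:R - (u == v)%:R.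
  rewrite (telescope_sumr_eq (fun j => - (u == w j v)%:R))//.
    by rewrite (wE (E v))// opprK addrC.
  by move=> j _; rewrite opprK addrC.
ring.
Qed.

Lemma closed_simplex_vertex (s : {fset V}) v :
  v \in s -> closed_simplex s (fun u => (u == v)%:R : R).
Proof.
move=> vs; split=> [u|u|]; rewrite ?ler0n//.
  by case: eqP => // ->; rewrite vs.
rewrite (big_fsetD1 v)//= eqxx big_seq big1 ?addr0// => u.
by rewrite !inE => /andP[/negbTE ->].
Qed.

Lemma closed_simplex_convex (s : {fset V}) (a : R) (x y : V -> R) :
  0 <= a <= 1 ->
  closed_simplex s x -> closed_simplex s y ->
  closed_simplex s (fun u => a * x u + (1 - a) * y u).
Proof.
move=> /andP[a0 a1] [x0 xs x1] [y0 ys y1]; split=> [u|u us|].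
- by rewrite addr_ge0 ?mulr_ge0// subr_ge0.
- by rewrite xs// ys// !mulr0 addr0.
- by rewrite big_split/= -!mulr_sumr x1 y1 !mulr1 addrC subrK.
Qed.

Theorem contiguous_sequence_contractible c :
  (forall v, simplices K [fset v]%fset -> w 0%N v = c) ->
  simplices K [fset c]%fset -> contractible_complex R K.
Proof.
move=> w0 Kc.
pose S v := [fset u | u in v :: [seq w e v | e <- iota 0 (E v).+1]]%fset.
apply: (@deform_contractible R V K track S _ _ _ c) => //.
- move=> s r Ks; have [r0|r0] := leP r 0.
    exists s => // v vs; rewrite (funext (fun u => track_before v u r0)).
    exact: closed_simplex_vertex.
  have [e [p0 p1]] := progress_time r0.
  exists (w e @` s `|` w e.+1 @` s)%fset; first exact: w_contig.
  move=> v vs.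
  rewrite (funext (fun u => trackE u (simplex_vertex Ks vs) p0 p1)).
  apply: closed_simplex_convex; first exact: progress_itv.
    by apply: closed_simplex_vertex; rewrite inE in_imfset.
  by apply: closed_simplex_vertex; rewrite inE (in_imfset _ (w e.+1)) ?orbT.
- move=> v r u Kv uS.
  have memS u' : (u' \in S v) =
      (u' == v) || (u' \in [seq w e v | e <- iota 0 (E v).+1]).
    apply/imfsetP/idP => [[z /= zl ->]|zl]; first by rewrite -in_cons.
    by exists u'; rewrite //= in_cons.
  have nu e : (e <= E v)%N -> u != w e v.
    move=> eE; apply: contra uS => /eqP ->; rewrite memS; apply/orP; right.
    by apply/mapP; exists e; rewrite ?mem_iota ?ltnS.
  have -> : track v r u = (u == v)%:R + 0.
    rewrite /track; congr +%R; rewrite big_nat big1// => e /andP[_ eE].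
    by rewrite !(negbTE (nu _ _)) ?subrr ?mulr0// ltnW.
  by rewrite addr0; move: uS; rewrite memS negb_or => /andP[/negbTE ->].
- move=> v u Kv r; apply: cvgD; first exact: cvg_cst.
  apply: cvg_big => [|e _]; first exact: add_continuous.
  apply: cvgM; last exact: cvg_cst.
  exact: progress_continuous.
- by move=> v u; rewrite track_before.
- move=> v u Kv; rewrite (@trackE _ _ _ 0%N)//.
    by rewrite progress1 ?mulr1 ?ler1n// subrr mul1r mul0r addr0 w0.
  by move=> j _; rewrite progress1// mulr1 ler1n.
Qed.

End ContiguousSequence.

Section Homotopic.
Context {V : choiceType} (K : simplicial_complex V).
Implicit Types (Q : set V) (f g h : V -> V).

Definition fixes Q f := forall v, Q v -> f v = v.

(** Contiguity is not transitive, whence chains.  The set [Q] records what is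
    left in place, as infinitely many chains can only be strung together if
    each vertex takes part in finitely many of them. *)
Inductive homotopic Q : (V -> V) -> (V -> V) -> Prop :=
| homotopic_refl f : fixes Q f -> contiguous K f f -> homotopic Q f f
| homotopic_step f g h :
    fixes Q f -> contiguous K f g -> homotopic Q g h -> homotopic Q f h.

Lemma contiguous_sym f g : contiguous K f g -> contiguous K g f.
Proof. by move=> fg s /fg; rewrite fsetUC. Qed.

Lemma contiguous_diag f g : contiguous K f g -> contiguous K f f.
Proof.
move=> fg s Ks; rewrite fsetUid.
apply: (simplex_face (fg s Ks)); first exact: fsubsetUl.
have /fset0Pn[v vs] := simplex_neq0 Ks.
by apply/fset0Pn; exists (f v); exact: in_imfset.
Qed.

Lemma homotopic_trans Q g f h :
  homotopic Q f g -> homotopic Q g h -> homotopic Q f h.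
Proof.
elim=> // {}f {}g h' fQ fg _ IH /IH; exact: homotopic_step.
Qed.

Lemma homotopic_edge Q f g :
  fixes Q f -> fixes Q g -> contiguous K f g -> homotopic Q f g.
Proof.
move=> fQ gQ fg; apply: (homotopic_step fQ fg); apply: homotopic_refl => //.
exact/contiguous_diag/contiguous_sym/fg.
Qed.

Lemma homotopic_sym Q f g : homotopic Q f g -> homotopic Q g f.
Proof.
elim=> [|{}f {}g h fQ fg gh IH]; first exact: homotopic_refl.
apply: (homotopic_trans IH).
by apply: homotopic_edge => //; [case: gh|exact: contiguous_sym].
Qed.

Lemma homotopic_path Q f g : homotopic Q f g ->
  exists n (p : nat -> V -> V), [/\ p 0 = f, forall i, n <= i -> p i = g,
    forall i, fixes Q (p i) & forall i, contiguous K (p i) (p i.+1)].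
Proof.
elim=> [{}f fQ ff|{}f {}g h fQ fg _ [n [p [p0 pn pQ pc]]]].
  by exists 0, (fun=> f).
exists n.+1, (fun i => if i is j.+1 then p j else f); split=> // -[|i] //=.
  exact: pn.
by rewrite p0.
Qed.

(** The finite chains between [chi n] and [chi n.+1] are strung together into
    one sequence of contiguous maps.  As they fix [Q n], which grows with [n], each
    vertex is fixed from some index on. *)
Theorem homotopic_sequence_contractible (R : realType) (chi : nat -> V -> V)
    (Q : nat -> set V) c :
  (forall n, homotopic (Q n) (chi n) (chi n.+1)) ->
  (forall m n, m <= n -> Q m `<=` Q n) ->
  (forall v, simplices K [fset v]%fset -> exists n, Q n v) ->
  (forall v, simplices K [fset v]%fset -> chi 0 v = c) ->
  simplices K [fset c]%fset -> contractible_complex R K.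
Proof.
move=> hom Qmono Qex chi0 Kc.
have /choice[l /choice[p pP]] := fun n => homotopic_path (hom n).
(* The state [(n, i)] is the [i]-th map of the [n]-th chain. *)
pose step (a : nat * nat) := if a.2 < l a.1 then (a.1, a.2.+1) else (a.1.+1, 0).
pose state e := iter e step (0, 0).
pose w e := p (state e).1 (state e).2.
have reach n : exists e, state e = (n, 0).
  elim: n => [|n [e eE]]; first by exists 0.
  have run i : i <= l n -> state (i + e) = (n, i).
    elim: i => [//|i IH il]; rewrite addSn [LHS]iterS -/(state _) IH 1?ltnW//.
    by rewrite /step/= il.
  exists (l n + e).+1; rewrite [LHS]iterS -/(state _) run// /step/= ltnn//.
have level e e' : e <= e' -> (state e).1 <= (state e').1.
  move/subnK => <-; elim: (e' - e) => // i IH.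
  apply: (leq_trans IH); rewrite addSn [state _.+1]iterS -/(state _) /step.
  by case: ifP.
have /choice[E EP] : forall v, exists n, simplices K [fset v]%fset ->
    forall e, n <= e -> w e v = v.
  move=> v; have [Kv|nKv] := pselect (simplices K [fset v]%fset);
    last by exists 0.
  have [n Qn] := Qex v Kv; have [e0 e0n] := reach n.
  exists e0 => _ e /level; rewrite e0n /= => ne.
  by have [_ _ pQ _] := pP (state e).1; apply: pQ; exact: Qmono Qn.
apply: (@contiguous_sequence_contractible R V K w E _ _ c) => //.
- move=> e; rewrite /w [state e.+1]iterS -/(state e) /step.
  have [_ pl _ pc] := pP (state e).1; case: ltnP => //= le.
  have [q0 ql _ qc] := pP (state e).1.+1; rewrite q0 pl// -q0.
  exact: contiguous_diag (qc 0).
- move=> v Kv; rewrite /w/=; have [-> _ _ _] := pP 0.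
  exact: chi0.
Qed.

End Homotopic.

(** * Finite index subgroups *)

Section FiniteIndex.
Local Open Scope group_scope.
Context {G : groupType}.
Implicit Types (H N L B C u v : set G) (g x y : G).

Lemma is_subgroupP H :
  is_subgroup H <-> H 1 /\ forall x y, H x -> H y -> H (x * y^-1).
Proof.
split=> [[h1 hB]|[h1 hB]].
  split=> [|x y /mem_set Hx /mem_set Hy]; apply: set_mem => //; exact: hB.
split; first exact: mem_set.
by move=> x y /set_mem Hx /set_mem Hy; apply: mem_set; exact: hB.
Qed.

Lemma subgroup1 H : is_subgroup H -> H 1.
Proof. by move=> /is_subgroupP[]. Qed.

Lemma subgroupV H x : is_subgroup H -> H x -> H x^-1.
Proof. by move=> /is_subgroupP[h1 hB] /(hB _ _ h1); rewrite mul1g. Qed.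

Lemma subgroupM H x y : is_subgroup H -> H x -> H y -> H (x * y).
Proof.
move=> sH Hx /(subgroupV sH) Hy; have /is_subgroupP[_ hB] := sH.
by have := hB _ _ Hx Hy; rewrite invgK.
Qed.

Lemma subgroupX H x n : is_subgroup H -> H x -> H (x ^+ n).
Proof.
move=> sH Hx; elim: n => [|n IH]; first by rewrite expg0; exact: subgroup1.
by rewrite expgS; exact: subgroupM.
Qed.

Lemma right_cosetE H g x : right_coset H g x <-> H (x * g^-1).
Proof.
split=> [[y Hy <-]|Hx]; first by rewrite mulgK.
by exists (x * g^-1) => //; rewrite mulgVK.
Qed.

Lemma right_coset_eq H x y : is_subgroup H ->
  right_coset H x = right_coset H y <-> H (x * y^-1).
Proof.
move=> sH; split=> [xy|Hxy].
  apply/right_cosetE; rewrite -xy; apply/right_cosetE; rewrite mulgV.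
  exact: subgroup1.
apply/seteqP; split=> z /right_cosetE Hz; apply/right_cosetE.
  by rewrite -[z](mulgVK x) -mulgA; exact: subgroupM.
rewrite -[z](mulgVK y) -mulgA; apply: subgroupM => //.
by rewrite -[y * x^-1]invgK invgM invgK; exact: subgroupV.
Qed.

(** Colourings by a finite type are easier to combine than finite sets of
    cosets: intersections correspond to pairs of colours, point stabilizers to
    the positions of the point. *)
Lemma finite_index_colouring H : is_subgroup H -> finite_index H ->
  exists (T : finType) (F : G -> T), forall x y, F x = F y <-> H (x * y^-1).
Proof.
move=> sH /finite_fsetP[S HS].
have HC x : right_coset H x \in S.
  have : right_cosets H (right_coset H x) by exists x.
  by rewrite HS.
exists S, (fun x => [` HC x]%fset) => x y.
rewrite -right_coset_eq//; split=> [/(congr1 val)//|xy].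
exact/val_inj.
Qed.

Lemma colouring_finite_index H (T : finType) (F : G -> T) : is_subgroup H ->
  (forall x y, F x = F y -> H (x * y^-1)) -> finite_index H.
Proof.
move=> sH FH.
pose r (t : T) := xget 1 [set x | F x = t].
apply: (@sub_finite_set _ _ ((fun t => right_coset H (r t)) @` [set: T])).
  move=> _ [x _ <-]; exists (F x) => //; apply/right_coset_eq => //; apply: FH.
  by rewrite /r; case: xgetP => [y _ //|/(_ x)/(_ erefl)].
exact/finite_image/finite_finset.
Qed.

Definition finite_index_subgroup H := is_subgroup H /\ finite_index H.

Lemma finite_index_subgroupT : finite_index_subgroup [set: G].
Proof.
have sT : is_subgroup [set: G] by apply/is_subgroupP.
by split=> //; exact: (@colouring_finite_index _ unit (fun=> tt)).
Qed.

Lemma finite_index_subgroup_sub H N : is_subgroup H -> N `<=` H ->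
  finite_index_subgroup N -> finite_index_subgroup H.
Proof.
move=> sH NH [sN /finite_index_colouring-/(_ sN)[T [F FN]]]; split=> //.
by apply: (@colouring_finite_index _ T F) => // x y /FN/NH.
Qed.

Lemma subgroupI H N : is_subgroup H -> is_subgroup N -> is_subgroup (H `&` N).
Proof.
move=> /is_subgroupP[H1 HB] /is_subgroupP[N1 NB].
apply/is_subgroupP; split=> // x y [Hx Nx] [Hy Ny].
by split; [exact: HB|exact: NB].
Qed.

Lemma finite_index_subgroupI H N : finite_index_subgroup H ->
  finite_index_subgroup N -> finite_index_subgroup (H `&` N).
Proof.
move=> [sH /finite_index_colouring-/(_ sH)[T [F FH]]].
move=> [sN /finite_index_colouring-/(_ sN)[T' [F' FN]]].
have sHN := subgroupI sH sN; split=> //.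
by apply: (@colouring_finite_index _ _ (fun x => (F x, F' x))) => // x y
  [/FH ? /FN].
Qed.

Definition core H : set G := [set g | forall x, H (x * g * x^-1)].

Lemma core_sub H : core H `<=` H.
Proof. by move=> g /(_ 1); rewrite mul1g invg1 mulg1. Qed.

Lemma core_normal H : is_subgroup H -> is_normal (core H).
Proof.
move=> sH; split.
  apply/is_subgroupP; split=> [x|g h cg ch x].
    by rewrite mulg1 mulgV; exact: subgroup1.
  have -> : x * (g * h^-1) * x^-1 = (x * g * x^-1) * (x * h * x^-1)^-1.
    by rewrite !invgM invgK !mulgA mulgVK.
  by have /is_subgroupP[_] := sH; apply.
move=> g h ch x; rewrite conjgE; have := ch (x * g^-1).
by rewrite invgM invgK !mulgA.
Qed.

(** [g] is coloured by the permutation of the cosets of [H] that it induces. *)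
Lemma core_finite_index H : finite_index_subgroup H ->
  finite_index_subgroup (core H).
Proof.
move=> [sH /finite_index_colouring-/(_ sH)[T [F FH]]].
have [sC _] := core_normal sH; split=> //.
pose r (t : T) := xget 1 [set x | F x = t].
have rF x : F (r (F x)) = F x.
  by rewrite /r; case: xgetP => [y _ //|/(_ x)/(_ erefl)].
apply: (@colouring_finite_index _ {ffun T -> T}
  (fun g => [ffun t => F (r t * g)])) => //.
move=> g h /ffunP gh x.
have := gh (F x); rewrite !ffunE => /FH.
rewrite invgM !mulgA => Hr.
have /FH Hx := rF x.
have -> : x * g * h^-1 * x^-1 =
    (r (F x) * x^-1)^-1 * (r (F x) * g * h^-1 * (r (F x))^-1) *
    (r (F x) * x^-1).
  by rewrite !invgM !invgK !mulgA mulgVK mulgVK.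
by apply: subgroupM => //; apply: subgroupM => //; exact: subgroupV.
Qed.

Lemma finite_index_exponent H x : finite_index_subgroup H ->
  exists2 e, (0 < e)%N & H (x ^+ e).
Proof.
move=> [sH /finite_index_colouring-/(_ sH)[T [F FH]]].
have : ~~ injectiveb (fun i : 'I_#|T|.+1 => F (x ^+ i)).
  apply/negP => /injectiveP/leq_card; by rewrite card_ord ltnn.
move=> /injectivePn[i [j ij /FH]].
wlog lt : i j ij / (j < i)%N.
  move=> wl; have [ji|ji|/val_inj ijE] := ltngtP j i.
  - exact: wl.
  - move=> /(subgroupV sH); rewrite invgM invgK => Hij.
    by apply: (wl j i) => //; rewrite eq_sym.
  - by rewrite ijE eqxx in ij.
by rewrite -expgnFr; [exists (i - j)%N; rewrite ?subn_gt0|exact: ltnW].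
Qed.

End FiniteIndex.

(** * Pushing cosets into a subgroup *)

Section Push.
Local Open Scope group_scope.
Context {G : groupType}.
Implicit Types (H N L B C u v : set G) (g x y : G).

(** Nonempty sets with this property are the cosets of subgroups. *)
Definition coset_closed C :=
  forall x y z, C x -> C y -> C z -> C (x * y^-1 * z).

Definition translate L v : set G := [set x * y | x in L & y in v].

Definition saturated N v := translate N v `<=` v.

Lemma right_coset_closed H g : is_subgroup H -> coset_closed (right_coset H g).
Proof.
move=> sH x y z /right_cosetE xg /right_cosetE yg /right_cosetE zg.
apply/right_cosetE.
have -> : x * y^-1 * z * g^-1 = (x * g^-1) * (y * g^-1)^-1 * (z * g^-1).
  by rewrite invgM invgK !mulgA mulgVK.
apply: subgroupM => //; apply: subgroupM => //; exact: subgroupV.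
Qed.

(** Describing cosets without mentioning their subgroup makes intersections and
    translates of cosets immediate.  The subgroup is recovered as the set of
    quotients [y * z^-1] of elements of [C]. *)
Lemma coset_posetP C : coset_poset G C <->
  [/\ exists x, C x, C != [set: G], coset_closed C
    & exists2 N, finite_index_subgroup N & saturated N C].
Proof.
split=> [[H [sH /eqP pH fH] [g _ <-]]|[[g Cg] /eqP CT hC [N [sN fN] NC]]].
  split.
  - by exists g; apply/right_cosetE; rewrite mulgV; exact: subgroup1.
  - apply/eqP => HT; apply: pH; apply/seteqP; split=> // x _.
    have /right_cosetE : right_coset H g (x * g) by rewrite HT.
    by rewrite mulgK.
  - exact: right_coset_closed.
  - exists H => // _ [x Hx [y /right_cosetE Hy <-]]; apply/right_cosetE.
    by rewrite -mulgA; exact: subgroupM.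
pose H := [set x | exists y z, [/\ C y, C z & x = y * z^-1]].
have HC x : H x -> C (x * g) by case=> y [z [Cy Cz ->]]; exact: hC.
have sH : is_subgroup H.
  apply/is_subgroupP; split; first by exists g, g; rewrite mulgV.
  move=> _ _ [y [z [Cy Cz ->]]] [y' [z' [Cy' Cz' ->]]].
  exists (y * z^-1 * z'), y'; split=> //; first exact: hC.
  by rewrite invgM invgK !mulgA.
exists H; first split=> //.
- apply/eqP => HT; apply: CT; apply/seteqP; split=> // x _.
  by rewrite -[x](mulgVK g); apply: HC; rewrite HT.
- apply: (finite_index_subgroup_sub sH _ (conj sN fN)).2 => n Nn.
  exists (n * g), g; rewrite mulgK; split=> //.
  by apply: NC; exists n => //; exists g.
exists g => //; apply/seteqP; split=> x.
  by move=> /right_cosetE/HC; rewrite mulgVK.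
by move=> Cx; apply/right_cosetE; exists x, g; split.
Qed.

Definition meets_all_cosets N M := forall g, exists2 n, N n & M (n * g).

(** The data of a push: which cosets stay put ([kept]), and how the others are
    coarsened ([blur]) before they are cut down ([target]). *)
Record stage := Stage { kept : set G; blur : set G; target : set G }.

(** [L] is normal so that saturations of cosets are cosets, and [L `<=` N] is
    needed for [push] to be monotone. *)
Definition valid_stage p := let: Stage N L B := p in
  [/\ is_normal L /\ finite_index_subgroup L, L `<=` N, is_subgroup N,
      proper_finite_index G B & meets_all_cosets L B].

(** Implies that [push p v `<=` push p' v] ([push_le]). *)
Definition stage_le p p' :=
  let: Stage N L B := p in let: Stage N' L' B' := p' in
  [/\ N' `<=` N, L `<=` N', L `<=` L' & B `<=` B'].

Definition push p v : set G :=
  if `[< saturated (kept p) v >] then v else translate (blur p) v `&` target p.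

Lemma translate_coset_closed L C :
  is_normal L -> coset_closed C -> coset_closed (translate L C).
Proof.
move=> [sL nL] hC _ _ _
  [l1 L1 [x1 C1 <-]] [l2 L2 [x2 C2 <-]] [l3 L3 [x3 C3 <-]].
exists (l1 * (l2^-1 * l3) ^ (x1 * x2^-1)^-1).
  apply: subgroupM => //; apply: nL; apply: subgroupM => //.
  exact: subgroupV.
exists (x1 * x2^-1 * x3); first exact: hC.
by rewrite conjgE !invgM !invgK !mulgA mulgVK mulgK.
Qed.

Lemma translateS L L' u v :
  L `<=` L' -> u `<=` v -> translate L u `<=` translate L' v.
Proof.
by move=> LL' uv _ [l /LL' Ll [x /uv ux <-]]; exists l => //; exists x.
Qed.

Lemma saturated_sub N L v : L `<=` N -> saturated N v -> saturated L v.
Proof. by move=> LN Nv x Lx; apply: Nv; exact: translateS Lx. Qed.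

(** A larger coset belongs to a larger subgroup: the left translates of [v] by
    [N] are seen on a single element of [v], which can be taken in [u].  This
    is what makes [push] monotone. *)
Lemma saturated_up N u v : coset_poset G u -> coset_poset G v -> u `<=` v ->
  saturated N u -> saturated N v.
Proof.
move=> /coset_posetP[[x ux] _ _ _] /coset_posetP[_ _ hv _] uv Nu
  _ [n Nn [z vz <-]].
rewrite -[n](mulgK x) -mulgA mulgA; apply: hv => //; last exact: uv.
by apply: uv; apply: Nu; exists n => //; exists x.
Qed.

Lemma push_coset p v :
  valid_stage p -> coset_poset G v -> coset_poset G (push p v).
Proof.
case: p => N L B [[nL fL] LN sN [sB /eqP pB fB] LB] Pv.
rewrite /push/=; case: ifPn => // _; apply/coset_posetP.
have /coset_posetP[[x vx] _ hv _] := Pv.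
split.
- have [l Ll Blx] := LB x; exists (l * x); split=> //.
  by exists l => //; exists x.
- apply/eqP => LBT; apply: pB; apply/seteqP; split=> // y _.
  by have [] : (translate L v `&` B) y by rewrite LBT.
- move=> a b c [La Ba] [Lb Bb] [Lc Bc]; split.
    exact: translate_coset_closed.
  by do 2?[apply: subgroupM => //]; exact: subgroupV.
- exists (L `&` B); first exact: finite_index_subgroupI.
  move=> _ [n [Ln Bn] [_ [[l Ll [y vy <-]] By] <-]].
  split; last exact: subgroupM.
  exists (n * l); first by case: nL => sL _; exact: subgroupM.
  by exists y; rewrite // mulgA.
Qed.

Lemma push_mono p u v : valid_stage p -> coset_poset G u -> coset_poset G v ->
  u `<=` v -> push p u `<=` push p v.
Proof.
case: p => N L B [_ LN _ _ _] Pu Pv uv; rewrite /push/=.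
case: asboolP => Nu; case: asboolP => Nv //.
- by have := saturated_up Pu Pv uv Nu.
- by move=> x [/(translateS LN uv)/Nv].
- by move=> x [/(translateS (@subset_refl _ L) uv)].
Qed.

Lemma push_le p p' v : stage_le p p' -> push p v `<=` push p' v.
Proof.
case: p p' => N L B [N' L' B'] /= [NN LN' LL BB]; rewrite /push/=.
case: asboolP => Nv; case: asboolP => N'v //.
- by have := saturated_sub NN Nv.
- by move=> x [/(translateS LN' (@subset_refl _ v))/N'v].
- by move=> x [/(translateS LL (@subset_refl _ v)) ? /BB].
Qed.

Lemma push_fixes p : fixes (saturated (kept p)) (push p).
Proof. by move=> v Nv; rewrite /push asboolT. Qed.

Lemma push_le_fixes p p' :
  stage_le p p' -> fixes (saturated (kept p)) (push p').
Proof.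
case: p p' => N L B [N' L' B'] [NN _ _ _] v Nv.
by apply: push_fixes; exact: saturated_sub NN Nv.
Qed.

Notation nerve := (nerve_complex (proper_finite_index G)).

(** If [g] lies in all cosets of a simplex, then the images under both maps
    contain [l * g], where [l] is chosen in [blur p] with [l * g] in
    [target p]. *)
Lemma push_contiguous_nerve p p' :
  valid_stage p -> valid_stage p' -> stage_le p p' ->
  contiguous nerve (push p) (push p').
Proof.
move=> sp sp' pp' s [s0 sP [g sg]]; split.
- have /fset0Pn[v vs] := s0.
  by apply/fset0Pn; exists (push p v); rewrite inE in_imfset.
- move=> C; rewrite inE => /orP[] /imfsetP[v /= vs ->];
    apply: push_coset => //; exact: sP.
- have [l Ll Bl] : exists2 l, blur p l & target p (l * g).
    by case: p sp {pp'} => N L B [_ _ _ _ /(_ g)].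
  have pv v : v \in s -> push p v (l * g).
    move=> vs; have vg : v g by exact: sg.
    have Lv : translate (blur p) v (l * g) by exists l => //; exists g.
    rewrite /push; case: asboolP => // Nv.
    apply: Nv; apply: translateS Lv => //.
    by case: p sp {pp' Ll Bl} => N L B [].
  exists (l * g) => C /=; rewrite inE => /orP[] /imfsetP[v /= vs ->].
    exact: pv.
  by apply: (push_le pp'); exact: pv.
Qed.

End Push.

Section OrderHomotopy.
Local Open Scope order_scope.
Context {d : Order.disp_t} {T : porderType d} (P : set T).

(** Monotone maps [f <= g] need not be contiguous: for [u < v], [g u] and [f v]
    may be incomparable.  Moving the vertices one height [h] at a time, the
    highest first, leaves this problem to vertices [u <= v] of equal height. *)
Lemma comparable_maps_homotopic (Q : set T) (f g : T -> T) (h : T -> nat) b :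
  (forall v, P v -> P (f v)) -> (forall v, P v -> P (g v)) ->
  (forall u v, P u -> P v -> u <= v -> f u <= f v) ->
  (forall u v, P u -> P v -> u <= v -> g u <= g v) ->
  (forall v, f v <= g v) ->
  (forall v, (h v <= b)%N) -> (forall u v, u <= v -> (h u <= h v)%N) ->
  (forall u v, P u -> P v -> u <= v -> h u = h v -> g u >=< f v) ->
  fixes Q f -> fixes Q g ->
  homotopic (order_complex P) Q f g.
Proof.
move=> fP gP fmono gmono fg hb hmono fgc fQ gQ.
pose w j v := if (j <= h v)%N then g v else f v.
have wP j v : P v -> P (w j v).
  by rewrite /w; case: ifP => _; [exact: gP|exact: fP].
have wQ j : fixes Q (w j).
  by move=> v Qv; rewrite /w; case: ifP => _; [exact: gQ|exact: fQ].
have wc j i i' u v : P u -> P v ->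
    (j <= i <= j.+1)%N -> (j <= i' <= j.+1)%N -> u <= v -> w i u >=< w i' v.
  move=> Pu Pv ij i'j uv; rewrite /w; have huv := hmono _ _ uv.
  case: ifP => iu; case: ifP => iv; last first.
  - exact/le_comparable/fmono.
  - by apply: le_comparable; apply: le_trans (fg _); exact: fmono.
  - apply: fgc => //; lia.
  - exact/le_comparable/gmono.
have wcontig j : contiguous (order_complex P) (w j) (w j.+1).
  move=> s [/fset0Pn[v0 vs] sP sC]; split.
  - by apply/fset0Pn; exists (w j v0); rewrite inE in_imfset.
  - by move=> x; rewrite inE => /orP[] /imfsetP[v /= /sP Pv ->]; exact: wP.
  - have im x : x \in (w j @` s `|` w j.+1 @` s)%fset -> exists v i,
        [/\ v \in s, (j <= i <= j.+1)%N & x = w i v].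
      rewrite inE => /orP[] /imfsetP[v /= vs' ->]; [exists v, j|exists v, j.+1];
        by split; rewrite // leqnn leqnSn.
    move=> x y /im[u [i [us ij ->]]] /im[v [i' [vs' ij' ->]]].
    have /orP[uv|vu] := sC _ _ us vs'; first by apply: (wc j) => //; exact: sP.
    by rewrite comparable_sym; apply: (wc j) => //; exact: sP.
have w0 : w 0%N = g by [].
have wb : w b.+1 = f.
  by apply/funext => v; rewrite /w leqNgt ltnS hb.
rewrite -wb -w0; apply: homotopic_sym; elim: b.+1 {wb hb} => [|j IH].
  by apply: homotopic_refl => //; exact: contiguous_diag (wcontig 0%N).
apply: homotopic_trans IH _; exact: homotopic_edge.
Qed.

End OrderHomotopy.

Section PushHomotopic.
Local Open Scope group_scope.
Context {G : groupType}.
Implicit Types (H N L B C u v : set G) (g x y : G).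

Notation nerve := (nerve_complex (proper_finite_index G)).
Notation order := (order_complex (coset_poset G)).

Lemma push_homotopic_nerve p p' :
  valid_stage p -> valid_stage p' -> stage_le p p' ->
  homotopic nerve (saturated (kept p)) (push p) (push p').
Proof.
move=> sp sp' pp'; apply: homotopic_edge.
- exact: push_fixes.
- exact: push_le_fixes.
- exact: push_contiguous_nerve.
Qed.

(** The height of [v] is the number of cosets of [blur p] that meet [v].  If
    [u `<=` v] have equal height, they meet the same cosets, so that [push p]
    sends them to the same place unless [v] is kept. *)
Lemma push_homotopic_order p p' :
  valid_stage p -> valid_stage p' -> stage_le p p' ->
  homotopic order (saturated (kept p)) (push p) (push p').
Proof.
move=> sp sp' pp'.
have [sL fL] : finite_index_subgroup (blur p) by case: p sp {pp'} => N L B [[]].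
have [T [F FL]] := finite_index_colouring sL fL.
pose colours v := finset (fun t : T => `[< exists2 x, v x & F x = t >]).
have coloursS u v : u `<=` v -> colours u \subset colours v.
  move=> uv; apply/fintype.subsetP => t; rewrite !inE => -[x ux xt].
  by exists x => //; exact: uv.
have translate_colours u v : colours v \subset colours u ->
    translate (blur p) v `<=` translate (blur p) u.
  move=> /fintype.subsetP vu _ [l Ll [x vx <-]].
  have : F x \in colours v by rewrite !inE; exists x.
  move=> /vu; rewrite !inE => -[y uy /esym yx]; have /FL xy := yx.
  exists (l * (x * y^-1)); first exact: subgroupM.
  by exists y; rewrite // !mulgA mulgVK.
apply: (@comparable_maps_homotopic _ _ _ _ _ _ (fun v => #|colours v|) #|T|).
- by move=> v; exact: push_coset.
- by move=> v; exact: push_coset.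
- by move=> u v Pu Pv; rewrite !subsetEset; exact: push_mono.
- by move=> u v Pu Pv; rewrite !subsetEset; exact: push_mono.
- by move=> v; rewrite subsetEset; exact: push_le.
- by move=> v; exact: max_card.
- by move=> u v; rewrite subsetEset => /coloursS/subset_leq_card.
- move=> u v Pu Pv; rewrite subsetEset => uv huv.
  have vu : colours v \subset colours u.
    have := eqEcard (colours u) (colours v).
    by rewrite coloursS// huv leqnn => /eqP ->.
  have [Nv|Nv] := pselect (saturated (kept p) v).
    rewrite (push_fixes Nv) -(push_le_fixes pp' Nv); apply: le_comparable.
    by rewrite subsetEset; exact: push_mono.
  have Nu : ~ saturated (kept p) u.
    by move=> Nu; exact/Nv/(saturated_up Pu Pv uv Nu).
  rewrite comparable_sym; apply: le_comparable; rewrite subsetEset.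
  move=> y; rewrite {1}/push asboolF// => -[/(translate_colours _ _ vu) Luy By].
  by apply: (push_le pp'); rewrite /push asboolF.
- exact: push_fixes.
- exact: push_le_fixes.
Qed.

End PushHomotopic.

Section Contraction.
Local Open Scope group_scope.
Context {R : realType} {G : groupType}.
Implicit Types (H N L B C u v : set G) (g x y : G).

Section Filtration.
Variable (L : nat -> set G) (M : set G -> set G).
Hypothesis L_fi : forall n, finite_index_subgroup (L n).
Hypothesis L_all : forall H, finite_index_subgroup H -> exists n, L n = H.
Hypothesis M_proper :
  forall N, finite_index_subgroup N -> proper_finite_index G (M N).
Hypothesis M_meets :
  forall N, finite_index_subgroup N -> meets_all_cosets N (M N).

(** Intersecting with [L m] makes the sequence cofinal among the finite index
    subgroups.  Intersecting with [M (filtration m)] allows one to meet two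
    consecutive targets at once: an element of [M (filtration m)] can be moved
    into the next target by [filtration m.+1], which does not lead out of
    [M (filtration m)]. *)
Fixpoint filtration n : set G :=
  if n is m.+1 then filtration m `&` core (L m `&` M (filtration m))
  else [set: G].

Lemma filtration_finite_index n :
  is_normal (filtration n) /\ finite_index_subgroup (filtration n).
Proof.
elim: n => [|n [[sN nN] fN]].
  split; last exact: finite_index_subgroupT.
  by split=> //; case: (@finite_index_subgroupT G).
have [sM pM fM] := M_proper fN.
have fLM : finite_index_subgroup (L n `&` M (filtration n)).
  exact: finite_index_subgroupI.
have [sC nC] := core_normal fLM.1.
split; last exact/finite_index_subgroupI/core_finite_index.
split; first exact: subgroupI.
by move=> g x [Nx Cx]; split; [exact: nN|exact: nC].
Qed.

Lemma filtrationS m n : (m <= n)%N -> filtration n `<=` filtration m.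
Proof.
move/subnK => <-; elim: (n - m)%N => // i IH; rewrite addSn.
by move=> x [/IH].
Qed.

(** Let [chi n] keep the cosets that are unions of cosets of [N n] and send any
    other coset [v] to [N n v `&` B n].  As [N 0] is the whole group, [chi 0]
    is constant; and every coset is kept by [chi n] for [n] large.  A zigzag of
    four comparisons leads from [chi n.+1] to [chi n]: restrict what is kept,
    saturate for [N n] instead of [N n.+1], cut down to [B n], and drop
    [B n.+1]. *)
Theorem filtration_contractible (K : simplicial_complex (set G)) :
  (forall v, simplices K [fset v]%fset <-> coset_poset G v) ->
  (forall p p', valid_stage p -> valid_stage p' -> stage_le p p' ->
     homotopic K (saturated (kept p)) (push p) (push p')) ->
  contractible_complex R K.
Proof.
move=> KP Khom.
pose N := filtration; pose B n := M (N n).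
pose chi n := push (Stage (N n) (N n) (B n)).
have nN n : is_normal (N n) /\ finite_index_subgroup (N n).
  exact: filtration_finite_index.
have fN n : finite_index_subgroup (N n) := (nN n).2.
have sN n : is_subgroup (N n) := (fN n).1.
have NB n : N n.+1 `<=` B n by move=> x [_ /core_sub[]].
have NS n : N n.+1 `<=` N n by exact: filtrationS.
have Bp n : proper_finite_index G (B n) by exact: M_proper.
have NmB n : meets_all_cosets (N n) (B n) by exact: M_meets.
have B0 : coset_poset G (B 0%N).
  exists (B 0%N) => //; exists 1 => //; apply/seteqP; split=> x.
    by move=> /right_cosetE; rewrite invg1 mulg1.
  by move=> Bx; apply/right_cosetE; rewrite invg1 mulg1.
apply: (@homotopic_sequence_contractible _ K R chi
  (fun n => saturated (N n)) (B 0%N)).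
- move=> n.
  have st0 : valid_stage (Stage (N n) (N n) (B n)).
    by split.
  have st4 : valid_stage (Stage (N n.+1) (N n.+1) (B n.+1)).
    by split.
  have st3 : valid_stage (Stage (N n) (N n.+1) (B n.+1)).
    by split.
  have st2 : valid_stage (Stage (N n) (N n) (B n.+1)).
    split=> //.
    by move=> g; have [l /NS Nl Bl] := NmB n.+1 g; exists l.
  have st1 : valid_stage (Stage (N n) (N n) (B n.+1 `&` B n)).
    have [sB pB iB] := Bp n; have [sB' /eqP pB' iB'] := Bp n.+1.
    have [sI fI] := finite_index_subgroupI (conj sB' iB') (conj sB iB).
    split=> //.
      split=> //; apply/eqP => IT; apply: pB'; apply/seteqP; split=> // x _.
      by have [] : (B n.+1 `&` B n) x by rewrite IT.
    move=> g; have [l Nl Bl] := NmB n g; have [l' Nl' Bl'] := NmB n.+1 (l * g).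
    exists (l' * l); first by apply: subgroupM => //; exact: NS.
    rewrite -mulgA; split=> //; apply: subgroupM => //; exact: NB.
  have hom p p' : valid_stage p -> valid_stage p' -> stage_le p p' ->
      kept p = N n -> homotopic K (saturated (N n)) (push p) (push p').
    by move=> sp sp' pp' <-; exact: Khom.
  apply: (homotopic_trans (g := push (Stage (N n) (N n) (B n.+1 `&` B n)))).
    by apply/homotopic_sym/hom => //; split=> // x [].
  apply: (homotopic_trans (g := push (Stage (N n) (N n) (B n.+1)))).
    by apply: hom => //; split=> // x [].
  apply: (homotopic_trans (g := push (Stage (N n) (N n.+1) (B n.+1)))).
    by apply/homotopic_sym/hom => //; split=> //; exact: NS.
  by apply: hom => //; split=> //; exact: NS.
- by move=> m n /filtrationS NN v; exact: saturated_sub.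
- move=> v /KP/coset_posetP[_ _ _ [H /L_all[n <-] Lv]].
  by exists n.+1; apply: saturated_sub Lv => x [_ /core_sub[]].
- move=> v /KP/coset_posetP[[x vx] /eqP vT _ _].
  have TvT : translate [set: G] v = [set: G].
    apply/seteqP; split=> // y _; exists (y * x^-1) => //.
    by exists x; rewrite // mulgVK.
  rewrite /chi /push/= asboolF ?TvT ?setTI// /saturated TvT => Tv.
  by apply: vT; apply/seteqP.
- by apply/KP.
Qed.

End Filtration.

Theorem coset_complexes_contractible :
    (exists L : nat -> set G, (forall n, finite_index_subgroup (L n)) /\
       forall H, finite_index_subgroup H -> exists n, L n = H) ->
    (forall N, finite_index_subgroup N ->
       exists2 M, proper_finite_index G M & meets_all_cosets N M) ->
  contractible_complex R (nerve_complex (proper_finite_index G)) /\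
  contractible_complex R (order_complex (coset_poset G)).
Proof.
move=> [L [Lfi Lall]] HM.
have /choice[M MP] : forall N, exists M, finite_index_subgroup N ->
    proper_finite_index G M /\ meets_all_cosets N M.
  move=> N; have [fN|nfN] := pselect (finite_index_subgroup N);
    last by exists setT.
  by have [M pM mM] := HM N fN; exists M.
split; apply: (@filtration_contractible L M) => //.
- by move=> N /MP[].
- by move=> N /MP[].
- move=> v; split=> [[_ vP _]|Pv]; first by apply: vP; rewrite inE.
  split; first by apply/fset0Pn; exists v; rewrite inE.
    by move=> C; rewrite in_fset1 => /eqP ->.
  have /coset_posetP[[x vx] _ _ _] := Pv.
  by exists x => C /=; rewrite in_fset1 => /eqP ->.
- exact: push_homotopic_nerve.
- by move=> N /MP[].
- by move=> N /MP[].
- move=> v; split=> [[_ vP _]|Pv]; first by apply: vP; rewrite inE.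
  split; first by apply/fset0Pn; exists v; rewrite inE.
    by move=> C; rewrite in_fset1 => /eqP ->.
  by move=> C C'; rewrite !in_fset1 => /eqP -> /eqP ->; exact: comparablexx.
- exact: push_homotopic_order.
Qed.

End Contraction.

(** * Finitely generated groups have countably many finite index subgroups *)

Section Enumeration.
Local Open Scope group_scope.
Context {G : groupType}.
Implicit Types (H : set G) (g x y : G) (s : seq G).

Definition spelled s (u : seq nat) : G := foldl (fun g i => g * nth 1 s i) 1 u.

Definition letters s := s ++ map (fun x => x^-1) s.

Lemma spelled_cat s u v : spelled s (u ++ v) = spelled s u * spelled s v.
Proof.
rewrite /spelled foldl_cat; move: (foldl _ 1 u) => a.
have fM b : foldl (fun g i => g * nth 1 s i) (a * b) v =
    a * foldl (fun g i => g * nth 1 s i) b v.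
  by elim: v b => //= i v IH b; rewrite -mulgA IH.
by rewrite -fM mulg1.
Qed.

Lemma spelled1 s i : spelled s [:: i] = nth 1 s i.
Proof. by rewrite /spelled/= mul1g. Qed.

Lemma finitely_generated_spelled s g :
    (forall K : set G, is_subgroup K -> [set` s] `<=` K -> K = [set: G]) ->
  exists2 u, all (fun i => i < size (letters s))%N u
    & g = spelled (letters s) u.
Proof.
move=> gen.
pose K := [set g | exists2 u, all (fun i => i < size (letters s))%N u
  & g = spelled (letters s) u].
have K1 : K 1 by exists [::].
have KM x y : K x -> K y -> K (x * y).
  move=> [u us ->] [v vs ->].
  by exists (u ++ v); rewrite ?all_cat ?us// spelled_cat.
have Kletter x : x \in letters s -> K x.
  move=> xs; exists [:: index x (letters s)]; first by rewrite /= index_mem xs.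
  by rewrite spelled1 nth_index.
have letterV x : x \in letters s -> x^-1 \in letters s.
  rewrite !mem_cat => /orP[xs|/mapP[y ys ->]]; apply/orP; [right|left].
    exact: map_f.
  by rewrite invgK.
have KV x : K x -> K x^-1.
  move=> [u us ->]; elim/last_ind: u us => [_|u i IH].
    by rewrite /spelled/= invg1.
  rewrite all_rcons -cats1 spelled_cat => /andP[il us].
  rewrite invgM; apply: KM (IH us); rewrite spelled1.
  by apply/Kletter/letterV/mem_nth.
suff KT : K = [set: G] by have : [set: G] g by []; rewrite -KT.
apply: gen.
  by apply/is_subgroupP; split=> // x y Kx Ky; apply: KM => //; exact: KV.
by move=> x xs; apply: Kletter; rewrite mem_cat; move: xs => /= ->.
Qed.

(** An automaton with transition table [t] reads [u], starting in state [c]. *)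
Definition run (t : seq (seq nat)) (c : nat) (u : seq nat) : nat :=
  foldl (fun c i => nth 0%N (nth [::] t c) i) c u.

Definition accepted s (c : nat) (t : seq (seq nat)) : set G :=
  [set g | exists u, [/\ all (fun i => i < size (letters s))%N u,
     g = spelled (letters s) u & run t c u = c]].

(** The automaton is the action of the letters on the cosets of [H]; an element
    lies in [H] when it fixes the coset [H]. *)
Lemma finite_index_accepted s H :
    (forall K : set G, is_subgroup K -> [set` s] `<=` K -> K = [set: G]) ->
  finite_index_subgroup H -> exists c t, H = accepted s c t.
Proof.
move=> gen [sH /finite_index_colouring-/(_ sH)[T [F FH]]].
pose r (k : T) := xget 1 [set x | F x = k].
have rF x : F (r (F x)) = F x.
  by rewrite /r; case: xgetP => [y _ //|/(_ x)/(_ erefl)].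
pose c x : nat := enum_rank (F x).
pose t := [seq [seq c (r k * a) | a <- letters s] | k <- enum T].
have FM x y a : F x = F y -> F (x * a) = F (y * a).
  by move=> /FH xy; apply/FH; rewrite invgM mulgA mulgK.
have runE x u : all (fun i => i < size (letters s))%N u ->
    run t (c x) u = c (x * spelled (letters s) u).
  elim/last_ind: u => [_|u i IH]; first by rewrite mulg1.
  rewrite all_rcons -cats1 => /andP[il us].
  rewrite spelled_cat /run foldl_cat/= -/(run t (c x) u) IH//.
  rewrite (nth_map (F x)) -?cardE ?ltn_ord// nth_enum_rank (nth_map 1)//.
  rewrite /c mulgA; congr (nat_of_ord (enum_rank _)); rewrite spelled1.
  exact: FM.
exists (c 1), t; apply/seteqP; split=> g.
  move=> Hg; have [u us gE] := finitely_generated_spelled g gen.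
  exists u; split=> //; rewrite runE// mul1g -gE /c.
  congr (nat_of_ord (enum_rank _)); apply/FH.
  by rewrite invg1 mulg1.
move=> [u [us ->]]; rewrite runE// mul1g => /val_inj/enum_rank_inj/FH.
by rewrite invg1 mulg1.
Qed.

Theorem finitely_generated_enumeration : finitely_generated G ->
  exists L : nat -> set G, (forall n, finite_index_subgroup (L n)) /\
    forall H, finite_index_subgroup H -> exists n, L n = H.
Proof.
move=> [s gen].
pose D n :=
  if (choice.unpickle n : option (nat * seq (seq nat))) is Some (c, t)
  then accepted s c t else setT.
exists (fun n => if `[< finite_index_subgroup (D n) >] then D n else setT).
split=> [n|H fH].
  by case: asboolP => // _; exact: finite_index_subgroupT.
have [c [t HE]] := finite_index_accepted gen fH.
exists (choice.pickle (c, t)).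
have -> : D (choice.pickle (c, t)) = H by rewrite /D choice.pickleK HE.
by rewrite asboolT.
Qed.

End Enumeration.

(** * A long cycle as a product of two permutations of given orders *)

Section Chain.
Implicit Types (f g : nat -> nat) (m n l s x : nat).

Definition rotate s l x :=
  if s <= x < s + l then (if x.+1 == s + l then s else x.+1) else x.

Definition supported m f :=
  (forall x, m <= x -> f x = x) /\ (forall x, x < m -> f x < m).

(** [f] acts on [{0, ..., m - 1}] as one cycle.  The last point is the base
    point because there the next cycle of the chain is attached; at least one
    step is required so that the base point itself recurs. *)
Definition sweeps m f := forall x, x < m -> exists i, iter i.+1 f m.-1 = x.

Lemma rotate_out s l x : ~~ (s <= x < s + l) -> rotate s l x = x.
Proof. by rewrite /rotate => /negbTE ->. Qed.

Lemma rotate_step s l x : s <= x -> x.+1 < s + l -> rotate s l x = x.+1.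
Proof.
by move=> sx xl; rewrite /rotate sx (ltnW xl) /= (ltn_eqF xl).
Qed.

Lemma rotate_last s l x : s <= x -> x.+1 = s + l -> rotate s l x = s.
Proof. by move=> sx xl; rewrite /rotate sx -xl leqnn eqxx. Qed.

Lemma rotate_in s l x : s <= x < s + l -> s <= rotate s l x < s + l.
Proof. rewrite /rotate; move=> h; rewrite h; case: eqP; lia. Qed.

Lemma rotate_iter s l x : iter l (rotate s l) x = x.
Proof.
have [h|/rotate_out h] := boolP (s <= x < s + l); last first.
  have id i : iter i (rotate s l) x = x by elim: i => // i IH; rewrite iterS IH.
  exact: id.
have up i y : s <= y -> y + i < s + l -> iter i (rotate s l) y = y + i.
  elim: i => [|i IH] sy yi; first by rewrite addn0.
  by rewrite iterS IH ?rotate_step; lia.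
have [k xk] : exists k, x + k.+1 = s + l by exists (s + l - x).-1; lia.
have e : l = (x - s) + k.+1 by lia.
rewrite {1}e iterD.
have -> : iter k.+1 (rotate s l) x = s.
  by rewrite iterS up ?rotate_last; lia.
by rewrite up; lia.
Qed.

Lemma iter_disjoint m f g l : supported m f ->
    (forall x, x < m -> g x = x) -> (forall x, m <= x -> m <= g x) ->
    (forall x, iter l f x = x) -> (forall x, iter l g x = x) ->
  (forall x, iter l (f \o g) x = x) /\ (forall x, iter l (g \o f) x = x).
Proof.
move=> [fout fin] gin gout fl gl.
have low h : (forall x, x < m -> h x = f x) -> forall i x, x < m ->
    iter i h x = iter i f x /\ iter i f x < m.
  move=> hf; elim=> // i IH x xm; have [e lt] := IH x xm.
  by rewrite !iterS e hf//; split=> //; exact: fin.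
have high h : (forall x, m <= x -> h x = g x) -> forall i x, m <= x ->
    iter i h x = iter i g x /\ m <= iter i g x.
  move=> hg; elim=> // i IH x xm; have [e lt] := IH x xm.
  by rewrite !iterS e hg//; split=> //; exact: gout.
split=> x; have [xm|mx] := ltnP x m.
- by rewrite (low _ _ l x xm).1// => y ym /=; rewrite gin.
- by rewrite (high _ _ l x mx).1// => y my /=; rewrite fout//; exact: gout.
- by rewrite (low _ _ l x xm).1// => y ym /=; rewrite gin//; exact: fin.
- by rewrite (high _ _ l x mx).1// => y my /=; rewrite fout.
Qed.

(** Two cycles with exactly one common point, here [m.-1], multiply to one cycle
    through all their points: the product follows [f], and whenever it comes
    to the common point, it makes a tour of the other cycle first. *)
Lemma sweeps_rotate m f l : 0 < m -> 1 < l -> (forall x, m <= x -> f x = x) ->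
  sweeps m f -> sweeps (m.-1 + l) (f \o rotate m.-1 l).
Proof.
move=> m0 l1 fout fm; set M := m.-1 + l; set g := f \o _.
have gtop : g M.-1 = f m.-1.
  by rewrite /g/= rotate_last; lia.
pose reach x := exists i, iter i.+1 g M.-1 = x.
have reachS x : reach x -> reach (g x) by move=> [i <-]; exists i.+1.
have reachf i : reach (iter i.+1 f m.-1).
  elim: i => [|i]; first by exists 0; rewrite /= gtop.
  rewrite [iter i.+2 _ _]iterS; move: (iter i.+1 f m.-1) => y ry.
  have [ym|ym|->] := ltngtP y m.-1.
  - suff <- : g y = f y by exact: reachS.
    by rewrite /g/= rotate_out//; lia.
  - by rewrite fout//; lia.
  - by exists 0; rewrite /= gtop.
have reachm : reach m.-1 by have [|i <-] := fm m.-1; [lia|exact: reachf].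
move=> x xM; have [xm|mx] := ltnP x m.
  by have [i <-] := fm x xm; exact: reachf.
suff : forall j, j < l -> reach (m.-1 + j).
  by move=> /(_ (x - m.-1)); rewrite subnKC; [apply; lia|lia].
elim=> [|j IH] jl; first by rewrite addn0.
have {}IH := IH (ltnW jl).
suff <- : g (m.-1 + j) = m.-1 + j.+1 by exact: reachS.
by rewrite /g/= rotate_step ?fout; lia.
Qed.

Lemma rotate_surj s l x :
  s <= x < s + l -> exists2 y, s <= y < s + l & rotate s l y = x.
Proof.
move=> h; have [sx|sx] := eqVneq x s.
  exists (s + l).-1; first by lia.
  by rewrite rotate_last; lia.
exists x.-1; first by lia.
by rewrite rotate_step; lia.
Qed.

(** The products in the two orders are conjugate. *)
Lemma sweeps_rotate_left m f l :
  0 < m -> 1 < l -> (forall x, m <= x -> f x = x) ->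
  sweeps m f -> sweeps (m.-1 + l) (rotate m.-1 l \o f).
Proof.
move=> m0 l1 fout fm x xM.
have sw := sweeps_rotate m0 l1 fout fm.
have conj i y : iter i (rotate m.-1 l \o f) (rotate m.-1 l y) =
    rotate m.-1 l (iter i (f \o rotate m.-1 l) y).
  by elim: i => // i IH; rewrite !iterS IH.
have [y yM <-] : exists2 y, y < m.-1 + l & rotate m.-1 l y = x.
  have [xm|mx] := ltnP x m.-1.
    by exists x => //; rewrite rotate_out//; lia.
  by have [|y ym <-] := @rotate_surj m.-1 l x; [lia|exists y => //; lia].
have [i <-] := sw y yM; exists i.+1.
rewrite iterSr -conj; congr (iter _ _ _).
by rewrite /= fout//; lia.
Qed.

(** Cycles of lengths [a] and [b], [k] of each, are attached alternately, each
    at the last point so far; [f] collects the former and [g] the latter. *)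
Lemma chain_of_cycles a b k : 1 < a -> 1 < b -> exists f g,
  let m := (k * (a + b - 2)).+1 in
  [/\ supported m f, supported m g, forall x, iter a f x = x,
      forall x, iter b g x = x & sweeps m (f \o g)].
Proof.
move=> a1 b1.
(* The last cycle attached belongs to [g], so that [f] fixes the last point:
   this leaves room for its next cycle. *)
suff [f [g [sf sg fa gb fg]]] : exists f g, let m := (k * (a + b - 2)).+1 in
  [/\ supported m.-1 f, supported m g, forall x, iter a f x = x,
      forall x, iter b g x = x & sweeps m (f \o g)].
  exists f, g; split=> //; case: sf => fout fin.
  split=> x xm; first by apply: fout; lia.
  have [xm1|xm1] := ltnP x (k * (a + b - 2)).+1.-1.
    by have := fin x xm1; lia.
  by rewrite fout.
elim: k => [|k [f [g [[fout fin] [gout gin] fa gb fg]]]].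
  by exists id, id; split=> //; [move=> x; elim: a {a1} => // *; rewrite iterS
    |move=> x; elim: b {b1} => // *; rewrite iterS|case=> // _; exists 0].
set m := (k * (a + b - 2)).+1 in fout fin gout gin fg.
have mE : (k.+1 * (a + b - 2)).+1 = (m.-1 + a).-1 + b 
  by rewrite /m mulSn; set q := k * _; clearbody q; lia.
rewrite mE => {mE}; set m1 := m.-1 + a.
have m1E : m1 = m.-1 + a by [].
have m0 : 0 < m by [].
clearbody m1 m.
exists (rotate m.-1 a \o f), (g \o rotate m1.-1 b); split.
- split=> x xm /=.
    by rewrite fout ?rotate_out//; lia.
  have [xm1|xm1] := ltnP x m.-1; last first.
    rewrite fout//; have [h|h] := boolP (m.-1 <= x < m.-1 + a).
      by have := rotate_in h; lia.
    by rewrite rotate_out//; lia.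
  by have fx := fin x xm1; rewrite rotate_out; lia.
- split=> x xm /=.
    by rewrite rotate_out ?gout//; lia.
  have [h|h] := boolP (m1.-1 <= x < m1.-1 + b).
    by have rx := rotate_in h; rewrite gout; lia.
  rewrite rotate_out//.
  have [xm1|xm1] := ltnP x m; last by rewrite gout; lia.
  by have := gin x xm1; lia.
- have [] // := @iter_disjoint m.-1 f (rotate m.-1 a) a.
  + by move=> x xm; rewrite rotate_out//; lia.
  + move=> x xm; have [h|h] := boolP (m.-1 <= x < m.-1 + a).
      by have := rotate_in h; lia.
    by rewrite rotate_out//; lia.
  + exact: rotate_iter.
- have [] // := @iter_disjoint m g (rotate m1.-1 b) b.
  + by move=> x xm; rewrite rotate_out//; lia.
  + move=> x xm; have [h|h] := boolP (m1.-1 <= x < m1.-1 + b).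
      by have := rotate_in h; lia.
    by rewrite rotate_out//; lia.
  + exact: rotate_iter.
- have sw1 : sweeps m1 (rotate m.-1 a \o (f \o g)).
    rewrite m1E; apply: sweeps_rotate_left => // x xm /=.
    by rewrite gout// fout//; lia.
  have := @sweeps_rotate m1 _ b _ b1 _ sw1; apply; first by lia.
  move=> x xm /=; rewrite gout; last by lia.
  by rewrite fout ?rotate_out//; lia.
Qed.

End Chain.

Section ChainPerm.
Local Open Scope group_scope.

Lemma perm_of_supported m f a :
  (0 < a)%N -> supported m f -> (forall x, iter a f x = x) ->
  exists2 s : {perm 'I_m}, s ^+ a = 1 & forall i, val (s i) = f i.
Proof.
move=> a0 [_ fin] fa.
pose F (i : 'I_m) := Ordinal (fin i (ltn_ord i)).
have Finj : injective F.
  move=> i j /(congr1 val) /= ij; apply: val_inj => /=.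
  by rewrite -(fa i) -(fa j) -(prednK a0) !iterSr ij.
exists (perm Finj) => [|i]; last by rewrite permE.
apply/permP => i; rewrite permX perm1; apply: val_inj; rewrite -[RHS]fa.
by elim: a {a0 fa} => // a IH; rewrite !iterS permE /= IH.
Qed.

(** With [e] cycles of each kind, [t * s] is a cycle of length
    [m = 1 + e (a + b - 2)], which is prime to [e]: hence already the powers of
    [(t * s) ^+ e] act transitively. *)
Lemma long_cycle_product a b e : (1 < a)%N -> (1 < b)%N -> (0 < e)%N ->
  exists m (s t : {perm 'I_m}) (z : 'I_m), [/\ s ^+ a = 1, t ^+ b = 1,
    (t * s) z != z & forall x, exists k, ((t * s) ^+ (e * k)) z = x].
Proof.
move=> a1 b1 e0.
have [f [g]] := chain_of_cycles e a1 b1.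
set d := a + b - 2; set m := (e * d).+1 => -[sf sg fa gb sw].
have [s sa sE] := perm_of_supported (ltnW a1) sf fa.
have [t tb tE] := perm_of_supported (ltnW b1) sg gb.
pose z : 'I_m := ord_max.
have iterE k : val (iter k (t * s) z) = iter k (f \o g) m.-1.
  by elim: k => // k IH; rewrite !iterS permM sE tE IH.
have reach x : exists k, iter k (t * s) z = x.
  have [k kE] := sw x (ltn_ord x); exists k.+1; apply: val_inj.
  by rewrite iterE kE.
have m2 : (1 < m)%N by rewrite /m /d; nia.
exists m, s, t, z; split=> //.
  apply/eqP => fixz; have [k kE] := reach (Ordinal (ltnW m2)).
  have : iter k (t * s) z = z by elim: k {kE} => // k IH; rewrite iterS IH.
  rewrite kE => /(congr1 val) /=; lia.
move=> x; have [k kE] := reach x.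
have orb : #|porbit (t * s) z| = m.
  rewrite -[RHS]card_ord; apply: eq_card => y; have [j <-] := reach y.
  by rewrite -permX mem_porbit.
have per : iter m (t * s) z = z by have := iter_porbit (t * s) z; rewrite orb.
(* [e * d = m.-1] is -1 modulo [m], so that [e * (d * m.-1)] is 1. *)
exists (d * m.-1 * k)%N; rewrite permX.
have -> : (e * (d * m.-1 * k) = k + (m - 2) * k * m)%N.
  have square q : (q.+1 * q.+1 * k = k + (q.+2 - 2) * k * q.+2)%N by lia.
  have -> : (e * (d * m.-1 * k) = (e * d) * (e * d) * k)%N by rewrite /= !mulnA.
  by move: m2; rewrite /m; case: (e * d)%N.
rewrite iterD; have -> : iter ((m - 2) * k * m) (t * s) z = z.
  by elim: (_ * k)%N => // j IH; rewrite mulSn iterD IH.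
by [].
Qed.

End ChainPerm.

(** * The amalgamated product *)

(** [G / H] is cyclic of order [n], generated by the class of [w]. *)
Section CyclicQuotient.
Local Open Scope group_scope.
Context {G : groupType} (H : set G) (w : G) (n : nat).
Hypothesis H_normal : is_normal H.
Hypothesis H_proper : is_proper H.
Hypothesis H_index : has_index H n.
Hypothesis H_repr : coset_representatives H (first_powers w n).

Let sH : is_subgroup H. Proof. by case: H_normal. Qed.

Lemma power_coset x : exists2 i, (i < n)%N & H (x * w ^- i).
Proof.
have [|_ [[[i /= ltin <-] xw] _]] := H_repr (C := right_coset H x).
  by exists x.
exists i => //; move/right_cosetE: xw => /(subgroupV sH).
by rewrite invgM invgK.
Qed.

(** If [w ^+ m] lies in [H], then [w ^+ i] with [i < m] represent all cosets. *)
Lemma index_le_power m : (0 < m)%N -> H (w ^+ m) -> (n <= m)%N.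
Proof.
move=> m0 Hm; rewrite -card_le_II -(card_le_eql H_index).
apply: card_le_trans (card_image_le (fun i => right_coset H (w ^+ i)) `I_m).
apply: subset_card_le => _ [x _ <-].
have [i _ Hi] := power_coset x.
exists (i %% m)%N; first exact: ltn_pmod.
apply/right_coset_eq => //.
have -> : w ^+ (i %% m) * x^-1 = (w ^+ (m * (i %/ m)))^-1 * (x * w ^- i)^-1.
  rewrite {3}(divn_eq i m) invgM invgK expgnDr !mulgA [(_ * m)%N]mulnC.
  by rewrite mulVg mul1g.
apply: subgroupM => //; apply: subgroupV => //.
by rewrite expgnA; exact: subgroupX.
Qed.

Lemma index_gt1 : (1 < n)%N.
Proof.
rewrite ltnNge; apply/negP => n1; move/eqP: H_proper; apply.
apply/seteqP; split=> // x _; have [i ltin Hi] := power_coset x.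
have i0 : i = 0%N by lia.
by move: Hi; rewrite i0 expg0 invg1 mulg1.
Qed.

Lemma power_index : H (w ^+ n).
Proof.
have [i ltin Hi] := power_coset (w ^+ n).
have := Hi; rewrite -expgnFr; last exact: ltnW.
case: i => [|i] in ltin Hi *; first by rewrite subn0.
move=> /(index_le_power _); lia.
Qed.

Lemma cyclic_quotient_morphism (K : groupType) (a : K) : a ^+ n = 1 ->
  exists f : G -> K,
    [/\ {morph f : x y / x * y}, f w = a & forall h, H h -> f h = 1].
Proof.
move=> an.
have mult i : H (w ^+ i) -> a ^+ i = 1.
  move=> Hi; rewrite (divn_eq i n) expgnDr mulnC expgnA an expg1n mul1g.
  have Hmod : H (w ^+ (i %% n)).
    have -> : w ^+ (i %% n) = (w ^+ n ^+ (i %/ n))^-1 * w ^+ i.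
      by rewrite {3}(divn_eq i n) expgnDr mulnC -expgnA mulgA mulVg mul1g.
    apply: subgroupM => //; apply: subgroupV => //; apply: subgroupX => //.
    exact: power_index.
  case: (posnP (i %% n)) => [->//|/index_le_power/(_ Hmod)].
  by rewrite leqNgt ltn_pmod// ltnW// index_gt1.
have uniq x i j : H (x * w ^- i) -> H (x * w ^- j) -> a ^+ i = a ^+ j.
  wlog ij : i j / (i <= j)%N.
    by move=> wl; have [/wl//|/ltnW/wl h ? ?] := leqP i j; apply/esym/h.
  move=> Hi Hj; rewrite -(subnK ij) expgnDr (mult (j - i)%N) ?mul1g//.
  have -> : w ^+ (j - i) = (x * w ^- j)^-1 * (x * w ^- i).
    by rewrite expgnFr// invgM invgK !mulgA mulgVK.
  by apply: subgroupM => //; exact: subgroupV.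
have /choice[e eP] : forall x, exists i, H (x * w ^- i).
  by move=> x; have [i _ Hi] := power_coset x; exists i.
exists (fun x => a ^+ e x); split=> [x y||h Hh].
- rewrite -expgnDr; apply: (uniq (x * y)) => //.
  have -> : x * y * w ^- (e x + e y) = (y * w ^- e y) ^ x^-1 * (x * w ^- e x).
    by rewrite expgnDr invgM conjgE invgK !mulgA mulgVK.
  by apply: subgroupM => //; apply: H_normal.2.
- rewrite -[RHS]expg1; apply: (uniq w) => //.
  by rewrite expg1 mulgV; exact: subgroup1.
- rewrite -[RHS](expg0 a); apply: (uniq h) => //.
  by rewrite expg0 invg1 mulg1.
Qed.

End CyclicQuotient.

Section AmalgamGeneration.
Local Open Scope group_scope.

Lemma subgroup_preimage (G K : groupType) (f : G -> K) (H : set K) :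
  {morph f : x y / x * y} -> is_subgroup H -> is_subgroup (f @^-1` H).
Proof.
move=> fM sH; have f1 : f 1 = 1 by apply: (mulgI (f 1)); rewrite -fM !mulg1.
apply/is_subgroupP; split=> [|x y Hx Hy] /=.
  by rewrite /preimage/= f1; exact: subgroup1.
have fV : f y^-1 = (f y)^-1 by apply: (mulgI (f y)); rewrite -fM !mulgV.
by rewrite /preimage/= fM fV; apply: subgroupM => //; exact: subgroupV.
Qed.

Lemma amalgam_finitely_generated (G1 G2 : groupType) (D : set G1)
    (psi : G1 -> G2) :
  finitely_generated G1 -> finitely_generated G2 ->
  finitely_generated (amalgam D psi).
Proof.
move=> [s1 gen1] [s2 gen2].
exists (map (amalgam_inl D psi) s1 ++ map (amalgam_inr D psi) s2) => K sK KS.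
have Kl x : K (amalgam_inl D psi x).
  suff : amalgam_inl D psi @^-1` K = [set: G1].
    by move/seteqP => [_ /(_ x)]; exact.
  apply: gen1; first exact: (subgroup_preimage (@amalgam_inlM _ _ D psi)).
  by move=> y /= ys; apply: KS; rewrite /= mem_cat map_f.
have Kr y : K (amalgam_inr D psi y).
  suff : amalgam_inr D psi @^-1` K = [set: G2].
    by move/seteqP => [_ /(_ y)]; exact.
  apply: gen2; first exact: (subgroup_preimage (@amalgam_inrM _ _ D psi)).
  by move=> x /= xs; apply: KS; rewrite /= mem_cat map_f// orbT.
apply/seteqP; split=> // a _; rewrite -[a]amalgam_wordK.
elim: (amalgam_word a) => [|l u IH]; first exact: subgroup1 sK.
rewrite -cat1s -amalgam_mulE; apply: (subgroupM sK) IH.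
by case: l => [x|y]; [exact: Kl|exact: Kr].
Qed.

End AmalgamGeneration.

Section Supplement.
Local Open Scope group_scope.

Lemma stabilizer_proper_finite_index (G : groupType) m
    (f : G -> {perm 'I_m}) (z : 'I_m) g :
  {morph f : x y / x * y} -> f g z != z ->
  proper_finite_index G [set x | f x z = z].
Proof.
move=> fM gz.
have fV y : f y^-1 = (f y)^-1.
  have f1 : f 1 = 1 by apply: (mulgI (f 1)); rewrite -fM !mulg1.
  by apply: (mulgI (f y)); rewrite -fM !mulgV.
have sM : is_subgroup [set x | f x z = z].
  apply/is_subgroupP; split=> [|x y /= xz yz] /=.
    have -> : 1 = g * g^-1 :> G by rewrite mulgV.
    by rewrite fM fV permM permK.
  by rewrite fM fV permM xz -{1}yz permK.
split=> //.
  apply/eqP => MT; have : [set x | f x z = z] g by rewrite MT.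
  by move=> /= /eqP; rewrite (negbTE gz).
apply: (@colouring_finite_index _ _ _ (fun x => f x z)) => // x y xy /=.
by rewrite fM fV permM xy permK.
Qed.

(** Take for [e] an exponent with [w ^+ e] in [N]: the powers of [w ^+ e] carry
    the point [f g^-1 z] to [z], and so some [n * g] with [n] in [N] fixes
    [z]. *)
Lemma supplement_of_long_cycles (G : groupType) (w : G) :
  (forall e, (0 < e)%N -> exists m (f : G -> {perm 'I_m}) (z : 'I_m),
    [/\ {morph f : x y / x * y}, f w z != z
      & forall x, exists k, ((f w) ^+ (e * k)) z = x]) ->
  forall N, finite_index_subgroup N ->
    exists2 M, proper_finite_index G M & meets_all_cosets N M.
Proof.
move=> cyc N fN; have [e e0 Ne] := finite_index_exponent w fN.
have [m [f [z [fM wz fk]]]] := cyc e e0.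
exists [set x | f x z = z]; first exact: stabilizer_proper_finite_index wz.
move=> g; have [k kE] := fk ((f g)^-1 z).
exists (w ^+ (e * k)).
  by rewrite expgnA; apply: subgroupX => //; case: fN.
have fX i : f (w ^+ i) = f w ^+ i.
  elim: i => [|i IH]; last by rewrite !expgS fM IH.
  by rewrite !expg0; apply: (mulgI (f 1)); rewrite -fM !mulg1.
by rewrite /= fM fX permM kE permKV.
Qed.

End Supplement.

Theorem theorem6p6 (R : realType) (G1 G2 : groupType)
    (H1 : set G1) (H2 : set G2) (psi : G1 -> G2)
    (w1 : G1) (w2 : G2) (n1 n2 : nat) (D : set G1) :
  finitely_generated G1 -> finitely_generated G2 ->
  is_normal H1 -> is_proper H1 -> has_index H1 n1 ->
  is_normal H2 -> is_proper H2 -> has_index H2 n2 ->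
  is_isomorphism H1 H2 psi ->
  coset_representatives H1 (first_powers w1 n1) ->
  coset_representatives H2 (first_powers w2 n2) ->
  is_subgroup D -> D `<=` H1 ->
  let G : groupType := amalgam D psi in
  contractible_complex R (nerve_complex (proper_finite_index G)) /\
  contractible_complex R (order_complex (coset_poset G)).
Proof.
move=> fg1 fg2 nH1 pH1 iH1 nH2 pH2 iH2 [_ psiH] rep1 rep2 _ DH1 G.
apply: coset_complexes_contractible.
  exact/finitely_generated_enumeration/amalgam_finitely_generated.
apply: (supplement_of_long_cycles
  (w := (amalgam_inr D psi w2 * amalgam_inl D psi w1)%g)) => e e0.
have n1_gt1 := index_gt1 nH1 pH1 iH1 rep1.
have n2_gt1 := index_gt1 nH2 pH2 iH2 rep2.
have [m [s [t [z [sn tn tsz tsk]]]]] := long_cycle_product n1_gt1 n2_gt1 e0.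
have [f1 [f1M f1w f1H]] := cyclic_quotient_morphism nH1 pH1 iH1 rep1 sn.
have [f2 [f2M f2w f2H]] := cyclic_quotient_morphism nH2 pH2 iH2 rep2 tn.
have f12 d : D d -> f1 d = f2 (psi d).
  move=> /DH1 Hd; rewrite f1H// f2H//.
  by case: psiH => psifun _ _; exact: psifun.
have [f [[fM fl fr] _]] := amalgam_universal f1M f2M f12.
by exists m, f, z; split=> //; rewrite fM fl fr f1w f2w.
Qed.
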